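(* Let $\lambda_0$ be an eigenvalue of $L$ with algebraic multiplicity $\chi(\lambda_0)$, and let $n_0$ denote the order of $\lambda_0$ as a zero of the function $\Delta(\lambda)$. Then $\chi(\lambda_0)=n_0$.
   Context: Let $J=(0,1)$. Let $b_0,b_1$ be measurable functions on $J$ with $b_0<0$ a.e. on $(0,1)$, such that $w:=-\frac{1}{b_0}$ and $\frac{b_1}{b_0}$ both belong to $L^1(J,\mathbb{C})$. Let $\nu_0,\nu_1$ be probability distributions (Borel probability measures) on $J=(0,1)$. $L^2_w(J,\mathbb{C})$ is the Hilbert space of complex-valued functions that are square integrable on $J$ with weight $w$, and $AC[0,1]$ is the set of absolutely continuous functions on $[0,1]$. The operator $L$ in $L^2_w(J,\mathbb{C})$ is defined by $$Ly:=b_0(x)y''+b_1(x)y',$$ $$\mathrm{dom}(L):=\Big\{y\in L^2_w(J,\mathbb{C}) : y,y'\in AC[0,1],\ Ly\in L^2_w(J,\mathbb{C}),\ y(0)=\int_0^1 y(x)\,\mathrm{d}\nu_0(x),\ y(1)=\int_0^1 y(x)\,\mathrm{d}\nu_1(x)\Big\}.$$ For $\lambda\in\mathbb{C}$, let $y_1(x,\lambda)$ and $y_2(x,\lambda)$ be the solutions of $b_0(x)y''(x)+b_1(x)y'(x)=\lambda y(x)$ determined by the initial conditions $y_1(0,\lambda)=y_2'(0,\lambda)=1$, $y_1'(0,\lambda)=y_2(0,\lambda)=0$ (where $'$ denotes the derivative in $x$). The characteristic function is $$\Delta(\lambda):=\det\begin{pmatrix}\int_0^1 y_1(x,\lambda)\,\mathrm{d}\nu_0(x)-1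 & \int_0^1 y_2(x,\lambda)\,\mathrm{d}\nu_0(x)\\ \int_0^1 y_1(x,\lambda)\,\mathrm{d}\nu_1(x)-y_1(1,\lambda) & \int_0^1 y_2(x,\lambda)\,\mathrm{d}\nu_1(x)-y_2(1,\lambda)\end{pmatrix},$$ which is an entire function of $\lambda$; $\lambda$ is an eigenvalue of $L$ if and only if $\Delta(\lambda)=0$. The algebraic multiplicity of an eigenvalue $\lambda_0$ of $L$ is the dimension of the generalized eigenspace $\bigcup_{n=1}^\infty\ker((L-\lambda_0 I)^n)$. *)

(* Defs.v *)
From HB Require Import structures.
From mathcomp Require Import all_boot all_order all_algebra.
From mathcomp Require Import all_classical all_reals all_analysis.
From mathcomp Require Export complex.

Set Implicit Arguments.
Unset Strict Implicit.
Unset Printing Implicit Defensive.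

Import Order.TTheory GRing.Theory Num.Theory.
Import numFieldNormedType.Exports.

Local Open Scope classical_set_scope.
Local Open Scope ring_scope.
Local Open Scope complex_scope.

Local Notation Re := complex.Re.
Local Notation Im := complex.Im.

Section ComplexFunctions.
Context {R : realType}.
Local Notation C := R[i].
Local Notation mu := (@lebesgue_measure R).

Definition unitJ : set R := `]0, 1[.

Definition aeq (f g : R -> C) : Prop := f = g %[ae mu in unitJ].

(* [measurable_fun] and [integrable] refer to the Borel sigma-algebra; a
   Lebesgue measurable (integrable) function on J is one that agrees almost
   everywhere with a Borel measurable (integrable) one. *)
Definition lmeasurable (f : R -> R) : Prop :=
  exists2 g : R -> R, measurable_fun unitJ g & f = g %[ae mu in unitJ].

Definition inL1 (f : R -> R) : Prop :=
  exists2 g : R -> R,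
    mu.-integrable unitJ (EFin \o g) & f = g %[ae mu in unitJ].

Definition clmeasurable (f : R -> C) : Prop :=
  lmeasurable (fun x => Re (f x)) /\ lmeasurable (fun x => Im (f x)).

Definition inL1C (f : R -> C) : Prop :=
  inL1 (fun x => Re (f x)) /\ inL1 (fun x => Im (f x)).

(* Elements of L^2_w(J, C) are represented by functions, two functions being
   the same element when they are [aeq]; values outside J are irrelevant. *)
Definition inL2 (w : R -> R) (f : R -> C) : Prop :=
  clmeasurable f /\ inL1 (fun x => Re `|f x| ^+ 2 * w x).

Definition AC01 (f : R -> C) : Prop :=
  forall e : R, 0 < e -> exists2 d : R, 0 < d &
    forall (n : nat) (a b : 'I_n -> R),
      (forall i, 0 <= a i /\ a i < b i /\ b i <= 1) ->
      trivIset [set: 'I_n] (fun i => `]a i, b i[%classic) ->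
      \sum_(i < n) (b i - a i) < d ->
      \sum_(i < n) Re `|f (b i) - f (a i)| < e.

Definition is_cderive (f : R -> C) (x : R) (df : C) : Prop :=
  is_derive x 1 (fun t => Re (f t)) (Re df) /\
  is_derive x 1 (fun t => Im (f t)) (Im df).

(* y, y' in AC[0,1], with [dy] = y' on [0,1] and [ddy] = y'' almost everywhere.
   At 0 and 1 the values of [dy] are the one-sided derivatives of y, by
   continuity of [dy] on [0,1].  An absolutely continuous function has a
   derivative almost everywhere, so that [ddy] always exists. *)
Definition AC2_derivs (y dy ddy : R -> C) : Prop :=
  [/\ AC01 y, AC01 dy,
      (forall x, unitJ x -> is_cderive y x (dy x)) &
      {ae mu, forall x, unitJ x -> is_cderive dy x (ddy x)}].

Definition Cintegral (nu : probability (measurableTypeR R) R) (f : R -> C) : C :=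
  (\int[nu]_(x in unitJ) Re (f x))%R +i* (\int[nu]_(x in unitJ) Im (f x))%R.

(* n is the order of z0 as a zero of the function f, holomorphic near z0 (n = 0
   when f z0 != 0). *)
Definition zero_order (f : C -> C) (z0 : C) (n : nat) : Prop :=
  exists g : C -> C,
    [/\ \forall z \near (z0 : C^o), derivable (g : C^o -> C^o) z 1,
        g z0 != 0 &
        \forall z \near (z0 : C^o), f z = (z - z0) ^+ n * g z].

(* Unbounded operators on the functions modulo [aeq] are given by their graphs:
   [A u v] means that u is in the domain of A and A u = v. *)
Definition op : Type := (R -> C) -> (R -> C) -> Prop.

Definition op_shift (A : op) (l : C) : op := fun u g =>
  exists2 v, A u v & aeq g (fun x => v x - l * u x).

Fixpoint op_pow (A : op) (n : nat) : op := fun u g =>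
  if n is m.+1 then exists2 v, A u v & op_pow A m v g else aeq g u.

Definition op_ker (A : op) : set (R -> C) := [set u | A u (fun=> 0)].

Definition eigenvalue_of (A : op) (l : C) : Prop :=
  exists2 u, op_ker (op_shift A l) u & ~ aeq u (fun=> 0).

Definition gen_eigenspace (A : op) (l : C) : set (R -> C) :=
  \bigcup_n op_ker (op_pow (op_shift A l) n.+1).

(* The subspace S of the functions modulo [aeq] has dimension n over C. *)
Definition has_dim (S : set (R -> C)) (n : nat) : Prop :=
  exists e : 'I_n -> R -> C,
    [/\ forall i, S (e i),
        forall c : 'I_n -> C,
          aeq (fun x => \sum_(i < n) c i * e i x) (fun=> 0) ->
          forall i, c i = 0 &
        forall u, S u ->
          exists c : 'I_n -> C, aeq u (fun x => \sum_(i < n) c i * e i x)].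

End ComplexFunctions.

Section Operator.
Context {R : realType}.
Local Notation C := R[i].
Local Notation mu := (@lebesgue_measure R).
Variables (b0 : R -> R) (b1 : R -> C).
Variables nu0 nu1 : probability (measurableTypeR R) R.

Definition weight : R -> R := fun x => - (b0 x)^-1.

Definition Lexpr (dy ddy : R -> C) : R -> C :=
  fun x => (b0 x)%:C * ddy x + b1 x * dy x.

(* The boundary values are those of the absolutely continuous representative
   [y] of the class of [u]. *)
Definition Lop : op := fun u f =>
  exists y dy ddy : R -> C,
    [/\ aeq u y, inL2 weight u & AC2_derivs y dy ddy] /\
    [/\ aeq f (Lexpr dy ddy), inL2 weight f,
        y 0 = Cintegral nu0 y & y 1 = Cintegral nu1 y].

(* y solves b0 y'' + b1 y' = l y with y(0) = c0 and y'(0) = c1. *)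
Definition is_solution (l c0 c1 : C) (y : R -> C) : Prop :=
  exists dy ddy : R -> C,
    [/\ AC2_derivs y dy ddy, aeq (Lexpr dy ddy) (fun x => l * y x),
        y 0 = c0 & dy 0 = c1].

Definition mx22 (a b c d : C) : 'M[C]_2 :=
  \matrix_(i < 2, j < 2)
    if i == 0 then (if j == 0 then a else b) else (if j == 0 then c else d).

Definition char_fun (y1 y2 : R -> C -> C) (l : C) : C :=
  \det (mx22
    (Cintegral nu0 (y1^~ l) - 1)       (Cintegral nu0 (y2^~ l))
    (Cintegral nu1 (y1^~ l) - y1 1 l)  (Cintegral nu1 (y2^~ l) - y2 1 l)).

End Operator.

(* Main.v *)
Require Import Defs.
From HB Require Import structures.
From mathcomp Require Import all_boot all_order all_algebra.
From mathcomp Require Import all_classical all_reals all_analysis.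
From mathcomp Require Import ring lra.

Set Implicit Arguments.
Unset Strict Implicit.
Unset Printing Implicit Defensive.

Import Order.TTheory GRing.Theory Num.Theory.
Import numFieldNormedType.Exports.

Local Open Scope classical_set_scope.
Local Open Scope ring_scope.
Local Open Scope complex_scope.

(** Put p = b1/b0 and w = -1/b0.  The equation (L - l) y = f then reads
      y'' = - p y' - w (l y + f),
    a linear equation with integrable coefficients.  Let U_0 and U_1 be the
    functionals sending y to the integral of y against nu_i minus y(i); the
    boundary conditions are U_0 y = U_1 y = 0 ([nonlocal_bc]).

    Expand the fundamental solutions formally in powers of t = l - lambda0:
    the coefficient z_{j,k} of t^k in y_j(., lambda0 + t) satisfies
    (L - lambda0) z_{j,k+1} = z_{j,k}, with zero initial data for k > 0
    ([jordan_chain]).  Hence every function annihilated by a power of the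
    differential expression L - lambda0 is a finite combination of the z_{j,k}
    ([sol_Phi]), uniquely so ([Phi_injective]).  Record its coefficients as a
    pair v of polynomials and write [Phi v] for the function; on coefficients,
    L - lambda0 is the shift that lowers the index k ([Phi_sol]).  The function
    belongs to the generalized eigenspace if and only if it and all its
    successive images satisfy the boundary conditions.  This says exactly that
    v is annihilated by the matrix
      M(t) = sum_k t^k (U_i z_{j,k})_{i,j},
    where t acts as the shift ([admissibleP]).

    What remains is algebra: if det M(t) = t^n q(t) with q(0) <> 0, the kernel of
    M on pairs of polynomials has dimension n ([ker2_basisP]).  Indeed, when
    n > 0 the matrix M(0) is singular, so that a change of basis of the columns
    makes one column divisible by t; this factor t, being a surjective shift with
    a kernel of dimension one, contributes one to the dimension and one to the
    order of the determinant.

    Finally det M(t) and Delta(lambda0 + t) have the same order at t = 0.  The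
    power series need not be summed: it suffices that the Taylor remainders of
    order N are O(t^N) ([chain_taylor]), since n0 is then read off from the
    truncations of M ([poly_order]), and since the kernels of these truncations
    only contain polynomials of size at most n0.

    The analysis rests on one fact: an absolutely continuous function whose
    derivative is nonpositive almost everywhere is nonincreasing
    ([primitive_nonincreasing]).  It gives uniqueness of primitives, and
    Gronwall's inequality without any integral ([gronwall_real]), whence
    uniqueness of solutions, the bound on Taylor remainders, and a lower bound on
    the Wronskian, which makes variation of parameters work ([sol_exists]). *)

Local Notation Re := complex.Re.
Local Notation Im := complex.Im.

(** * Monotonicity of absolutely continuous functions *)

Section RealAnalysis.
Context {R : realType}.
Local Notation mu := (@lebesgue_measure R).

Lemma ae_imp2 (P1 P2 Q : R -> Prop) : {ae mu, forall x, P1 x} ->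
  {ae mu, forall x, P2 x} ->
  (forall x, P1 x -> P2 x -> Q x) -> {ae mu, forall x, Q x}.
Proof.
move=> HP1 HP2 PQ.
have : mu.-negligible (~` [set x | P1 x] `|` ~` [set x | P2 x]).
  exact: negligibleU.
apply: negligibleS => x /= nQ; apply: contrapT => /not_orP[].
by move=> /contrapT p1 /contrapT p2; apply: nQ; exact: PQ.
Qed.

Lemma ae_imp (P Q : R -> Prop) : {ae mu, forall x, P x} ->
  (forall x, P x -> Q x) -> {ae mu, forall x, Q x}.
Proof. by move=> HP PQ; apply: (ae_imp2 HP HP) => x p _; exact: PQ. Qed.

(** The property has to be carried across a neighbourhood of every point, from
    left of the point to right of it; then the supremum of the points that can
    be reached cannot be smaller than b. *)
Lemma real_induction (P : R -> Prop) (a b : R) : a <= b -> P a ->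
  (forall x, a <= x <= b -> exists2 d, 0 < d &
    forall u v, a <= u -> u <= x -> x <= v -> v <= b -> x - d < u -> v < x + d ->
      P u -> P v) ->
  P b.
Proof.
move=> ab Pa step; pose S := [set x | a <= x <= b /\ P x].
have Sa : S a by split => //; rewrite lexx.
have hS : has_sup S by split; [exists a | exists b => x [/andP[]]].
have aS : a <= sup S by exact: ub_le_sup hS.2 _ Sa.
have Sb : sup S <= b by apply: ge_sup; [exists a | move=> x [/andP[]]].
have [|d d0 H] := step (sup S); first by rewrite aS.
have [u [/andP[au ub] Pu] ud] := sup_adherent d0 hS.
have us : u <= sup S by apply: ub_le_sup hS.2 _ _; split => //; rewrite au.
have [bd|bd] := ltP b (sup S + d); first exact: (H u b).
have Sv : S (sup S + d / 2).
  split; first by apply/andP; split; lra.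
  by apply: (H u) => //; lra.
have := ub_le_sup hS.2 Sv; lra.
Qed.

Lemma is_derive_approx (f : R -> R) (x c e : R) : is_derive x 1 f c -> 0 < e ->
  exists2 d, 0 < d & forall y, `|y - x| < d ->
    `|f y - f x - c * (y - x)| <= e * `|y - x|.
Proof.
move=> [fx fc] e0.
have : h^-1 *: ((f \o shift x) (h *: 1) - f x) @[h --> 0^'] --> c.
  by rewrite -fc; exact: fx.
move/cvgrPdist_le => /(_ _ e0) [d /= d0 H].
exists d => // y yd; have [->|yx] := eqVneq y x.
  by rewrite !subrr mulr0 subrr normr0 mulr0.
have nz : y - x != 0 by rewrite subr_eq0.
have := H (y - x); rewrite /= sub0r normrN => /(_ yd nz).
rewrite [_ *: 1]mulr1 subrK -[_ *: _]/(_ * _) => Hc.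
have -> : f y - f x - c * (y - x) = - (c - (y - x)^-1 * (f y - f x)) * (y - x).
  by field.
by rewrite normrM normrN ler_wpM2r.
Qed.

Definition ac (f : R -> R) : Prop :=
  forall e : R, 0 < e -> exists2 d : R, 0 < d &
    forall (n : nat) (a b : 'I_n -> R),
      (forall i, 0 <= a i /\ a i < b i /\ b i <= 1) ->
      trivIset [set: 'I_n] (fun i => `]a i, b i[%classic) ->
      \sum_(i < n) (b i - a i) < d ->
      \sum_(i < n) `|f (b i) - f (a i)| < e.

Definition primitive (f g : R -> R) : Prop :=
  ac f /\ {ae mu, forall x, unitJ x -> is_derive x 1 f (g x)}.

(** Lists allow a family of intervals to be extended by one interval at a time.
    They run from right to left, so that a new rightmost interval is put in
    front. *)
Lemma ac_seq (f : R -> R) (e : R) : ac f -> 0 < e -> exists2 d : R, 0 < d &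
  forall l : seq (R * R), all (fun p => [&& 0 <= p.1, p.1 < p.2 & p.2 <= 1]) l ->
    pairwise (fun p q => q.2 <= p.1) l ->
    \sum_(p <- l) (p.2 - p.1) < d -> \sum_(p <- l) `|f p.2 - f p.1| < e.
Proof.
move=> acf e0; have [d d0 H] := acf _ e0; exists d => // l lall lpw.
rewrite !(big_nth (0, 0)) !big_mkord.
apply: (H (size l) (fun i => (nth (0, 0) l i).1) (fun i => (nth (0, 0) l i).2)).
  by move=> i; have /(all_nthP (0, 0))/(_ i (ltn_ord i))/and3P[] := lall.
have lt_disj (i j : 'I_(size l)) x : (i < j)%N ->
    x \in `](nth (0, 0) l i).1, (nth (0, 0) l i).2[ ->
    x \in `](nth (0, 0) l j).1, (nth (0, 0) l j).2[ -> False.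
  move=> ij; rewrite !in_itv /= => /andP[x1 _] /andP[_ x2].
  have /(pairwiseP (0, 0)) := lpw.
  move=> /(_ i j); rewrite !inE => /(_ (ltn_ord _) (ltn_ord _) ij) x3.
  by move: (lt_trans x1 x2); rewrite ltNge x3.
move=> i j _ _ [x [/= xi xj]]; apply/val_inj => /=.
by case: (ltngtP i j) => // ij; [case: (lt_disj _ _ x ij) | case: (lt_disj _ _ x ij)].
Qed.

(** Cover the null set where the derivative is not under control, together with
    the end points, by an open set U so small that the variation of f over
    disjoint intervals contained in U is less than e.  Moving from a to the
    right, f grows by at most e (v - u) across a good point, while an interval
    [u, v] around a bad point can be chosen inside U and added to the list of
    intervals whose variation is controlled globally. *)
Lemma primitive_nonincreasing (f g : R -> R) : primitive f g ->
  {ae mu, forall x, unitJ x -> g x <= 0} ->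
  forall a b : R, 0 <= a -> a <= b -> b <= 1 -> f b <= f a.
Proof.
move=> [acf fg] g0 a b a0 ab b1.
suff H (e : R) : 0 < e -> f b - f a <= e * (b - a) + e.
  apply/ler_addgt0Pl => e e0; have {}e0 : 0 < e / 2 by lra.
  have /= := H _ e0; nra.
move=> e0; have [d d0 {}acf] := ac_seq acf e0.
have [N [mN N0 subN]] : exists N : set (measurableTypeR R), [/\ measurable N,
    mu N = 0%E & ~` [set x | unitJ x -> is_derive x 1 f (g x) /\ g x <= 0] `<=` N].
  by apply: (ae_imp2 fg g0) => x h1 h2 ux; split; [exact: h1 | exact: h2].
pose N' : set (measurableTypeR R) := N `|` [set 0; 1].
have m01 : measurable ([set 0; 1] : set (measurableTypeR R)) by apply: measurableU.
have mN' : measurable N' by apply: measurableU.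
have N'0 : mu N' = 0%E.
  by rewrite !null_set_setU //; exact: lebesgue_measure_set1.
have [|U [oU N'U mUN]] := lebesgue_regularity_outer mN' _ d0.
  by rewrite -[X in (X < _)%E]/(mu N') N'0 ltry.
have mU : measurable U by exact: measurable_realfun.open_measurable.
have {mUN} muU : (mu U < d%:E)%E.
  have mUN' : measurable (U `\` N' : set (measurableTypeR R)) by exact: measurableD.
  have := measureU2 mu mUN' mN'; rewrite setDKU // => /le_lt_trans; apply.
  by move: mUN; rewrite -[X in (_ + X < _)%E]/(mu N') N'0 adde0.
(* The part of U used up when x has been reached. *)
pose V (x : R) : set (measurableTypeR R) := U `&` `]a, x[.
have mV x : measurable (V x) by apply: measurableI.
have step_len u v : a <= u -> u <= v -> `]u, v[ `<=` U ->
    (mu (V u) + (v - u)%:E <= mu (V v))%E.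
  move=> au uv uvU.
  have -> : (v - u)%:E = mu `]u, v[.
    by rewrite lebesgue_measure_itv /= lte_fin; case: ltgtP uv => // ->; rewrite subrr.
  rewrite -measureU //.
    apply: le_measure; [by rewrite inE; exact: measurableU | by rewrite inE | ].
    rewrite /V => x [[Ux]|uvx]; rewrite /= in_itv /=.
      by move=> /andP[ax xu]; split => //; rewrite in_itv /= ax (lt_le_trans xu).
    split; first exact: uvU.
    move: uvx; rewrite /= !in_itv /= => /andP[ux ->]; rewrite andbT.
    exact: le_lt_trans ux.
  apply/seteqP; split => // x [[_]]; rewrite /= !in_itv /= => /andP[_ xu] /andP[ux _].
  by move: (lt_trans xu ux); rewrite ltxx.
have V_mono u v : u <= v -> (mu (V u) <= mu (V v))%E.
  move=> uv; apply: le_measure; [by rewrite inE | by rewrite inE | ].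
  move=> x [Ux]; rewrite /= !in_itv /=.
  by move=> /andP[ax xu]; split => //; rewrite /= in_itv /= ax (lt_le_trans xu).
(* The intervals of l are the ones accounted for by absolute continuity; the
   length condition bounds their total length by the measure of U. *)
pose P x := exists l : seq (R * R),
  [/\ all (fun p => [&& a <= p.1, p.1 < p.2 & p.2 <= x]) l,
      pairwise (fun p q => q.2 <= p.1) l,
      ((\sum_(p <- l) (p.2 - p.1))%:E <= mu (V x))%E &
      f x - f a <= e * (x - a) + \sum_(p <- l) `|f p.2 - f p.1|].
suff [l [lall lpw lmu lf]] : P b.
  apply: (le_trans lf); rewrite lerD2l; apply/ltW/acf => //.
    apply: sub_all lall => p /and3P[ap pp pb].
    by rewrite (le_trans a0 ap) pp (le_trans pb b1).
  rewrite -lte_fin (le_lt_trans lmu)// (le_lt_trans _ muU)// le_measure ?inE //.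
  exact: subIsetl.
apply: (real_induction ab).
  by exists [::]; split; rewrite ?big_nil ?subrr ?mulr0 ?addr0//=.
move=> x /andP[ax xb]; have [xN|xN] := pselect (N' x).
  have /= : nbhs x U by apply: open_nbhs_nbhs; split => //; exact: N'U.
  move=> /nbhs_ballP[r /= r0 xrU]; exists r => // u v au ux xv vb ru vr [l [lall lpw lmu lf]].
  have [uv|vu] := ltP u v; last first.
    have <- : u = v by apply/eqP; rewrite eq_le vu (le_trans ux).
    by exists l.
  exists ((u, v) :: l); split.
  - rewrite /= au uv lexx /=; apply: sub_all lall => p /and3P[-> -> pu] /=.
    by rewrite (le_trans pu (ltW uv)).
  - by rewrite /= lpw andbT; apply: sub_all lall => p /and3P[].
  - rewrite big_cons /= EFinD addeC.
    apply: le_trans (step_len u v au (ltW uv) _); first exact: leeD2r.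
    move=> y; rewrite /= in_itv /= => /andP[uy yv]; apply: xrU.
    by rewrite /ball /= ltr_norml; apply/andP; split; lra.
  - rewrite big_cons /=; have := ler_norm (f v - f u).
    have : 0 <= e * (v - u) by rewrite mulr_ge0 ?subr_ge0 ?ltW.
    move: lf; lra.
have [xJ [fx gx]] : unitJ x /\ is_derive x 1 f (g x) /\ g x <= 0.
  have xJ : unitJ x.
    rewrite /unitJ /= in_itv /= !lt_neqAle; apply/andP; split; apply/andP; split.
    - by apply: contra_notN xN => /eqP <-; right; left.
    - exact: le_trans ax.
    - by apply: contra_notN xN => /eqP ->; right; right.
    - exact: le_trans b1.
  split => //; apply: contrapT => H; apply: xN; left; apply: subN => /= /(_ xJ) //.
have [r r0 H] := is_derive_approx fx e0.
exists r => // u v au ux xv vb ru vr [l [lall lpw lmu lf]].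
have fux : f x - f u <= e * (x - u).
  have := H u; rewrite ltr_norml => /(_ _) H1.
  have {}H1 := H1 ltac:(apply/andP; split; lra).
  move: (ler_norm (- (f u - f x - g x * (u - x)))); rewrite normrN.
  have : 0 <= - g x * (x - u) by rewrite mulr_ge0 ?subr_ge0 ?oppr_ge0.
  rewrite (ler0_norm (_ : u - x <= 0)) ?subr_le0 // in H1.
  move: H1; lra.
have fxv : f v - f x <= e * (v - x).
  have := H v; rewrite ltr_norml => /(_ _) H1.
  have {}H1 := H1 ltac:(apply/andP; split; lra).
  move: (ler_norm (f v - f x - g x * (v - x))).
  have : 0 <= - g x * (v - x) by rewrite mulr_ge0 ?subr_ge0 ?oppr_ge0.
  rewrite (ger0_norm (_ : 0 <= v - x)) ?subr_ge0 // in H1.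
  move: H1; lra.
exists l; split => //.
- apply: sub_all lall => p /and3P[-> -> pu] /=.
  by rewrite (le_trans pu (le_trans ux xv)).
- exact: le_trans lmu (V_mono _ _ (le_trans ux xv)).
- move: lf; lra.
Qed.

End RealAnalysis.

(** * Calculus of absolutely continuous functions *)

Section AbsoluteContinuity.
Context {R : realType}.
Local Notation mu := (@lebesgue_measure R).

(** All the closure properties of absolute continuity below are instances of
    this criterion. *)
Lemma ac_dominated (f g1 g2 : R -> R) (c1 c2 : R) : ac g1 -> ac g2 ->
  (forall x y, 0 <= x <= 1 -> 0 <= y <= 1 ->
    `|f y - f x| <= c1 * `|g1 y - g1 x| + c2 * `|g2 y - g2 x|) ->
  ac f.
Proof.
move=> ac1 ac2 H e e0; pose c := `|c1| + `|c2| + 1.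
have c0 : 0 < c by rewrite ltr_wpDl ?addr_ge0.
have ec0 : 0 < e / 2 / c by rewrite !divr_gt0.
have [d1 d10 H1] := ac1 _ ec0; have [d2 d20 H2] := ac2 _ ec0.
exists (Num.min d1 d2); first by rewrite lt_min d10.
move=> n a b ab tab; rewrite lt_min => /andP[s1 s2].
have {H1} := H1 n a b ab tab s1; have {H2} := H2 n a b ab tab s2.
set S1 := \sum_i _; set S2 := \sum_i _ => lt1 lt2.
apply: (@le_lt_trans _ _ (c * S2 + c * S1)).
  rewrite !mulr_sumr -big_split /=; apply: ler_sum => i _.
  have [a0 [abi b1]] := ab i.
  have := H (a i) (b i); rewrite a0 b1 (le_trans a0 (ltW abi)) (le_trans (ltW abi) b1).
  move=> /(_ isT isT) /le_trans; apply; apply: lerD; rewrite ler_wpM2r //.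
  - by apply: le_trans (ler_norm c1) _; rewrite /c -addrA lerDl addr_ge0.
  - by apply: le_trans (ler_norm c2) _; rewrite /c addrAC lerDr addr_ge0.
move: lt1 lt2; rewrite !ltr_pdivlMr // => lt1 lt2.
move: lt1 lt2; rewrite (mulrC S1) (mulrC S2); lra.
Qed.

Lemma ac_cst (c : R) : ac (fun=> c).
Proof.
move=> e e0; exists 1 => // n a b _ _ _.
by rewrite big1 // => i _; rewrite subrr normr0.
Qed.

Lemma ac_eq (f g : R -> R) : (forall x, 0 <= x <= 1 -> f x = g x) -> ac f -> ac g.
Proof.
move=> fg acf; apply: (ac_dominated (c1 := 1) (c2 := 0) acf acf) => x y xI yI.
by rewrite !fg // mul1r mul0r addr0.
Qed.

Lemma acD (f g : R -> R) : ac f -> ac g -> ac (f \+ g).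
Proof.
move=> acf acg; apply: (ac_dominated (c1 := 1) (c2 := 1) acf acg) => x y _ _ /=.
by rewrite !mul1r (le_trans _ (ler_normD _ _)) // opprD addrACA.
Qed.

Lemma acZ (c : R) (f : R -> R) : ac f -> ac (fun x => c * f x).
Proof.
move=> acf; apply: (ac_dominated (c1 := `|c|) (c2 := 0) acf acf) => x y _ _ /=.
by rewrite mul0r addr0 -normrM mulrBr.
Qed.

Lemma ac_uniform (f : R -> R) : ac f -> forall e, 0 < e -> exists2 d, 0 < d &
  forall x y, 0 <= x <= 1 -> 0 <= y <= 1 -> `|y - x| < d -> `|f y - f x| < e.
Proof.
move=> acf e e0; have [d d0 H] := ac_seq acf e0; exists d => //.
suff H' x y : 0 <= x -> x <= y -> y <= 1 -> y - x < d -> `|f y - f x| < e.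
  move=> x y /andP[x0 x1] /andP[y0 y1] xyd; have [xy|yx] := leP x y.
    by apply: H' => //; apply: le_lt_trans xyd; exact: ler_norm.
  rewrite distrC; apply: H' => //; first exact: ltW.
  by rewrite distrC in xyd; apply: le_lt_trans xyd; exact: ler_norm.
move=> x0; rewrite le_eqVlt => /orP[/eqP <-|xy] y1 xyd; first by rewrite subrr normr0.
by have := H [:: (x, y)]; rewrite !big_seq1 /= x0 xy y1; apply.
Qed.

Lemma ac_bounded (f : R -> R) : ac f ->
  exists2 B, 0 < B & forall x, 0 <= x <= 1 -> `|f x| <= B.
Proof.
move=> acf; have [d d0 H] := ac_uniform acf (ltr01 : 0 < 1 :> R).
suff [B HB] : exists B, forall x, 0 <= x <= 1 -> `|f x| <= B.
  exists (`|B| + 1); first by rewrite ltr_wpDl.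
  by move=> x xI; rewrite (le_trans (HB _ xI))// ler_wpDr// ler_norm.
apply: (@real_induction _ (fun s => exists B, forall x, 0 <= x <= s -> `|f x| <= B)
   0 1 ler01).
  exists `|f 0| => x; rewrite -eq_le => /eqP <-; exact: lexx.
move=> x xI; exists (d / 2); first by rewrite divr_gt0.
move=> u v u0 ux xv v1 du dv [B HB]; exists (B + 1) => y /andP[y0 yv].
have [yu|uy] := leP y u; first by rewrite ler_wpDr// HB ?y0.
have -> : f y = f u + (f y - f u) by rewrite addrC subrK.
apply: (le_trans (ler_normD _ _)); apply: lerD; first by rewrite HB ?u0 ?lexx.
apply/ltW/H; first by rewrite u0 (le_trans ux) //; case/andP: xI.
  by rewrite y0 (le_trans yv).
rewrite gtr0_norm ?subr_gt0//; lra.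
Qed.

Lemma acM (f g : R -> R) : ac f -> ac g -> ac (f \* g).
Proof.
move=> acf acg.
have [B B0 HB] := ac_bounded acf; have [C C0 HC] := ac_bounded acg.
apply: (ac_dominated (c1 := C) (c2 := B) acf acg) => x y xI yI /=.
have -> : f y * g y - f x * g x = (f y - f x) * g x + f y * (g y - g x) by ring.
apply: (le_trans (ler_normD _ _)); rewrite !normrM.
by apply: lerD; [rewrite mulrC ler_wpM2r ?HC | rewrite ler_wpM2r ?HB].
Qed.

Lemma ac_expR (f : R -> R) : ac f -> ac (fun x => expR (f x)).
Proof.
move=> acf; have [B B0 HB] := ac_bounded acf.
apply: (ac_dominated (c1 := expR B) (c2 := 0) acf acf) => x y xI yI.
rewrite mul0r addr0.
(* Convexity of exp replaces the mean value theorem. *)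
have key (a b : R) : a <= B -> expR a - expR b <= expR B * `|a - b|.
  move=> aB; have := expR_ge1Dx (b - a); rewrite -(ler_pM2l (expR_gt0 a)).
  rewrite -expRD (_ : a + (b - a) = b) => [H|]; last by ring.
  have H1 : expR a - expR b <= expR a * (a - b) by lra.
  apply: (le_trans H1); apply: (le_trans (ler_wpM2l (expR_ge0 _) (ler_norm _))).
  by rewrite ler_wpM2r // ler_expR.
have fB z : 0 <= z <= 1 -> f z <= B by move=> zI; rewrite (le_trans (ler_norm _)) ?HB.
have k1 := key (f y) (f x) (fB _ yI); have k2 := key (f x) (f y) (fB _ xI).
by rewrite ler_norml; rewrite distrC in k2; apply/andP; split; [lra | exact: k1].
Qed.

Lemma unitJ_bounds (x : R) : unitJ x -> 0 <= x <= 1.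
Proof. by rewrite /unitJ /= in_itv /= => /andP[/ltW -> /ltW ->]. Qed.

Lemma unitJ_near (x : R) : unitJ x -> \forall y \near x, unitJ y.
Proof.
move=> xJ; apply: open_nbhs_nbhs; split => //; exact: interval_open.
Qed.

Lemma ac_continuous_at (f : R -> R) (x : R) : ac f -> unitJ x -> {for x, continuous f}.
Proof.
move=> acf xJ; apply/cvgrPdist_lt => e e0.
have [d d0 H] := ac_uniform acf e0.
near=> y; apply: H; [apply: unitJ_bounds; near: y; exact: unitJ_near|
  exact: unitJ_bounds | near: y].
by apply/nbhs_ballP; exists d.
Unshelve. all: by end_near. Qed.

Lemma ac_measurable (f : R -> R) : ac f -> measurable_fun (unitJ : set R) f.
Proof.
move=> acf; apply: measurable_realfun.open_continuous_measurable_fun.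
  exact: interval_open.
by move=> x; rewrite inE => xJ; exact: ac_continuous_at.
Qed.

Lemma primitiveD (f g f' g' : R -> R) : primitive f f' -> primitive g g' ->
  primitive (f \+ g) (f' \+ g').
Proof.
move=> [acf df] [acg dg]; split; first exact: acD.
apply: (ae_imp2 df dg) => x Hf Hg xJ.
by have h1 := Hf xJ; have h2 := Hg xJ; exact: is_deriveD.
Qed.

Lemma primitiveZ (c : R) (f f' : R -> R) : primitive f f' ->
  primitive (fun x => c * f x) (fun x => c * f' x).
Proof.
move=> [acf df]; split; first exact: acZ.
by apply: (ae_imp df) => x Hf xJ; have h := Hf xJ; exact: is_deriveZ.
Qed.

Lemma primitiveM (f g f' g' : R -> R) : primitive f f' -> primitive g g' ->
  primitive (f \* g) (fun x => f' x * g x + f x * g' x).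
Proof.
move=> [acf df] [acg dg]; split; first exact: acM.
apply: (ae_imp2 df dg) => x Hf Hg xJ.
have h1 := Hf xJ; have h2 := Hg xJ; have := is_deriveM h1 h2.
by move/is_derive_eq; apply; rewrite addrC [g x *: _]mulrC.
Qed.

Lemma primitive_cst (c : R) : primitive (fun=> c) (fun=> 0).
Proof.
by split; [exact: ac_cst | apply: aeW => x _; exact: is_derive_cst].
Qed.

Lemma primitive_expR (f f' : R -> R) : primitive f f' ->
  primitive (fun x => expR (f x)) (fun x => f' x * expR (f x)).
Proof.
move=> [acf df]; split; first exact: ac_expR.
apply: (ae_imp df) => x Hf xJ; have h := Hf xJ.
by apply: (is_derive_eq (is_derive1_comp (is_derive_expR (f x)) h)); rewrite mulrC.
Qed.

Lemma primitive_eq (f g f' g' : R -> R) : (forall x, 0 <= x <= 1 -> f x = g x) ->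
  {ae mu, forall x, unitJ x -> f' x = g' x} -> primitive f f' -> primitive g g'.
Proof.
move=> fg f'g' [acf df]; split; first exact: ac_eq acf.
apply: (ae_imp2 df f'g') => x Hf Hf' xJ; rewrite -Hf' //; have h := Hf xJ.
apply: near_eq_is_derive h.
by apply: filterS (unitJ_near xJ) => y /unitJ_bounds; exact: fg.
Qed.

(** This is the uniqueness half of the fundamental theorem of calculus, which
    fails for functions that are merely continuous. *)
Lemma primitive0_cst (f : R -> R) : primitive f (fun=> 0) ->
  forall x, 0 <= x <= 1 -> f x = f 0.
Proof.
move=> pf x /andP[x0 x1]; apply/eqP; rewrite eq_le; apply/andP; split.
  apply: (primitive_nonincreasing pf) => //.
  by apply: aeW.
have := primitiveZ (-1) pf; rewrite mulr0 => pNf.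
have := primitive_nonincreasing pNf _ (lexx 0) x0 x1.
rewrite !mulN1r lerN2; apply; exact: aeW.
Qed.

End AbsoluteContinuity.

(** * Indefinite integrals *)

Section Primitives.
Context {R : realType}.
Local Notation mu := (@lebesgue_measure R).
Local Notation J := (unitJ : set (measurableTypeR R)).

Lemma measurable_unitJ : measurable J.
Proof. exact: measurable_itv. Qed.

Lemma inL1_ae (f g : R -> R) : {ae mu, forall x, unitJ x -> f x = g x} ->
  inL1 f -> inL1 g.
Proof.
move=> fg [h ih fh]; exists h => //.
by apply: (ae_imp2 fg fh) => x E1 E2 xJ; rewrite -E1 // E2.
Qed.

Lemma inL1D (f g : R -> R) : inL1 f -> inL1 g -> inL1 (fun x => f x + g x).
Proof.
move=> [f' if' ff'] [g' ig' gg']; exists (fun x => f' x + g' x).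
  by have := integrableD measurable_unitJ if' ig'.
by apply: (ae_imp2 ff' gg') => x E1 E2 xJ; rewrite E1 // E2.
Qed.

Lemma inL1Z (c : R) (f : R -> R) : inL1 f -> inL1 (fun x => c * f x).
Proof.
move=> [f' if' ff']; exists (fun x => c * f' x).
  by have := integrableZl measurable_unitJ c if'.
by apply: (ae_imp ff') => x E1 xJ; rewrite E1.
Qed.

Lemma inL1_norm (f : R -> R) : inL1 f -> inL1 (fun x => `|f x|).
Proof.
move=> [f' if' ff']; exists (fun x => `|f' x|).
  by have := integrable_abse if'.
by apply: (ae_imp ff') => x E1 xJ; rewrite E1.
Qed.

Lemma ac_bounded_near (f : R -> R) : ac f -> [bounded f x | x in unitJ].
Proof.
move=> acf; have [B B0 HB] := ac_bounded acf.
exists B; split; first exact: num_real.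
by move=> M BM x xJ; apply: (le_trans (HB _ (unitJ_bounds xJ))); exact: ltW.
Qed.

Lemma inL1_acM (f g : R -> R) : ac f -> inL1 g -> inL1 (fun x => f x * g x).
Proof.
move=> acf [g' ig' gg']; exists (fun x => f x * g' x).
  by have := integrableMr measurable_unitJ (ac_measurable acf) (ac_bounded_near acf) ig'.
by apply: (ae_imp gg') => x E1 xJ; rewrite E1.
Qed.

Lemma ac_integrable (nu : {measure set (measurableTypeR R) -> \bar R}) (f : R -> R) :
  (nu unitJ < +oo)%E -> ac f -> nu.-integrable unitJ (EFin \o f).
Proof.
move=> nuJ acf; apply: measurable_bounded_integrable => //.
- exact: measurable_unitJ.
- exact: ac_measurable.
- exact: ac_bounded_near.
Qed.

Lemma lebesgue_unitJ_fin : (mu unitJ < +oo)%E.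
Proof. by rewrite /unitJ lebesgue_measure_itv /= lte_fin ltr01 -EFinB ltry. Qed.

Lemma inL1_ac (f : R -> R) : ac f -> inL1 f.
Proof.
move=> acf; exists f; last exact: aeW.
by apply: ac_integrable => //; exact: lebesgue_unitJ_fin.
Qed.

(** The indefinite integral from -oo of the extension of g by zero: Lebesgue's
    differentiation theorem gives its derivative, and the absolute continuity of
    the integral, applied to the union of a finite family of intervals, makes it
    absolutely continuous. *)
Lemma integral_primitive (g : R -> R) : mu.-integrable unitJ (EFin \o g) ->
  exists2 F, primitive F g &
    forall x, unitJ x -> {for x, continuous g} -> is_derive x 1 F (g x).
Proof.
move=> ig; pose G := g \_ unitJ.
have iG : mu.-integrable setT (EFin \o G).
  have /integrable_mkcond := ig; rewrite restrict_EFin; apply; exact: measurable_unitJ.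
pose F x := (\int[mu]_(t in `]-oo, x]) G t)%R.
have iGy (y : R) : mu.-integrable `]-oo, y] (EFin \o G) by exact: integrableS iG.
exists F; last first.
  move=> x xJ gx; have Gg : G x = g x by rewrite /G patchE mem_set.
  have Gx : {for x, continuous G}.
    rewrite /prop_for /continuous_at Gg; apply: cvg_trans gx.
    apply: near_eq_cvg; apply: filterS (unitJ_near xJ) => y yJ.
    by rewrite /G patchE mem_set.
  have xx1 : x < x + 1 by rewrite ltrDl.
  have /= [dF F'] := continuous_FTC1 (a := -oo%O) xx1 (iGy _) (ltNyr x) Gx.
  by split => //; rewrite -derive1E F'.
split; last first.
  have locG : locally_integrable setT G.
    by apply: open_integrable_locally => //; exact: openT.
  have /= H := FTC1Ny iGy locG.
  apply: (ae_imp H) => x [dF F'] xJ; split => //.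
  by rewrite -derive1E F' /G patchE mem_set.
have FB (x y : R) : x <= y -> F y - F x = \int[mu]_(t in `]x, y]) G t.
  move=> xy; by rewrite /F Rintegral_itvB ?bnd_simp.
move=> e e0; have [d [d0 H]] := integral_normr_continuous iG e0.
exists d => // n a b ab tab sd.
pose E (i : 'I_n) : set (measurableTypeR R) := `]a i, b i[%classic.
have mE i : measurable (E i) by exact: measurable_itv.
have mU : measurable (\big[setU/set0]_(i < n) E i) by apply: bigsetU_measurable.
have muE i : mu (E i) = (b i - a i)%:E.
  by rewrite /E lebesgue_measure_itv /= lte_fin; have [_ [-> _]] := ab i.
have := H _ mU; rewrite measure_bigsetU_ord // => H1.
have {H1} : (\int[mu]_(x in \big[setU/set0]_(i < n) E i) `|G x| < e)%R.
  by apply: H1; rewrite (eq_bigr _ (fun i _ => muE i)) sumEFin lte_fin.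
apply: le_lt_trans.
have -> : (\int[mu]_(x in \big[setU/set0]_(i < n) E i) `|G x|)%R =
    \sum_(i < n) (\int[mu]_(x in E i) `|G x|)%R.
  rewrite /Rintegral ge0_integral_bigsetU //=.
  - rewrite -sum_fine // => i _; apply: integrable_fin_num => //.
    by apply: integrableS (integrable_abse iG).
  - exact: index_enum_uniq.
  - by apply: sub_trivIset tab.
  - have /integrableP[mG _] := integrable_abse iG.
    exact: (measurable_funS measurableT (@subsetT _ _) mG).
apply: ler_sum => i _; have [_ [abi _]] := ab i.
rewrite (FB _ _ (ltW abi)) -Rintegral_itv_bndo_bndc; last by apply: integrableS iG.
by apply: le_normr_Rintegral => //; exact: integrableS iG.
Qed.

Lemma primitive_exists (g : R -> R) : inL1 g -> exists2 F, primitive F g & F 0 = 0.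
Proof.
move=> [g' ig' gg']; have [F pF _] := integral_primitive ig'.
exists (fun x => F x - F 0); last by rewrite subrr.
apply: (primitive_eq _ _ (primitiveD pF (primitive_cst (- F 0)))) => //.
by apply: (ae_imp gg') => x E xJ; rewrite E //= addr0.
Qed.

Lemma primitive_unique (f1 f2 g : R -> R) : primitive f1 g -> primitive f2 g ->
  forall x, 0 <= x <= 1 -> f1 x - f1 0 = f2 x - f2 0.
Proof.
move=> p1 p2 x xI.
have p0 : primitive (fun x => f1 x + -1 * f2 x) (fun=> 0).
  apply: primitive_eq (primitiveD p1 (primitiveZ (-1) p2)) => //.
  by apply: aeW => y _ /=; rewrite mulN1r subrr.
by have := primitive0_cst p0 xI; lra.
Qed.

(** An arbitrary primitive differs by a constant from the indefinite integral,
    which is differentiable wherever the integrand is continuous. *)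
Lemma primitive_is_derive (f g : R -> R) : primitive f g -> ac g ->
  forall x, unitJ x -> is_derive x 1 f (g x).
Proof.
move=> pf acg x xJ.
have ig : mu.-integrable unitJ (EFin \o g).
  by apply: ac_integrable => //; exact: lebesgue_unitJ_fin.
have [F pF /(_ x xJ (ac_continuous_at acg xJ)) dF] := integral_primitive ig.
have -> : g x = g x + 0 by rewrite addr0.
apply: near_eq_is_derive (is_deriveD dF (is_derive_cst (f 0 - F 0) x 1)).
apply: filterS (unitJ_near xJ) => y /unitJ_bounds yI.
by have := primitive_unique pf pF yI; rewrite fctE /=; lra.
Qed.

End Primitives.

(** * Complex-valued absolutely continuous functions *)

Section ComplexAC.
Context {R : realType}.
Local Notation C := R[i].
Local Notation mu := (@lebesgue_measure R).

(** In R[i] the norm takes values in R[i]; estimates are made in R instead. *)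
Definition cabs (z : C) : R := Re `|z|.

Lemma cReD (z t : C) : Re (z + t) = Re z + Re t. Proof. by case: z t => ? ? []. Qed.
Lemma cImD (z t : C) : Im (z + t) = Im z + Im t. Proof. by case: z t => ? ? []. Qed.
Lemma cReN (z : C) : Re (- z) = - Re z. Proof. by case: z. Qed.
Lemma cImN (z : C) : Im (- z) = - Im z. Proof. by case: z. Qed.
Lemma cReM (z t : C) : Re (z * t) = Re z * Re t - Im z * Im t.
Proof. by case: z t => ? ? []. Qed.
Lemma cImM (z t : C) : Im (z * t) = Re z * Im t + Im z * Re t.
Proof. by case: z t => ? ? []. Qed.

Lemma complexP (z t : C) : Re z = Re t -> Im z = Im t -> z = t.
Proof. by case: z t => ? ? [? ?] /= -> ->. Qed.

Lemma cabsE (z : C) : `|z| = (cabs z)%:C.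
Proof. by case: z. Qed.

Lemma cabs_ge0 (z : C) : 0 <= cabs z.
Proof. by rewrite -ler0c -cabsE normr_ge0. Qed.

Lemma cabs0 : cabs 0 = 0.
Proof. by apply: complexI; rewrite -cabsE normr0. Qed.

Lemma cabs1 : cabs 1 = 1.
Proof. by apply: complexI; rewrite -cabsE normr1. Qed.

Lemma cabsN (z : C) : cabs (- z) = cabs z.
Proof. by apply: complexI; rewrite -!cabsE normrN. Qed.

Lemma cabsM (z t : C) : cabs (z * t) = cabs z * cabs t.
Proof. by apply: complexI; rewrite rmorphM /= -!cabsE normrM. Qed.

Lemma cabsV (z : C) : cabs z^-1 = (cabs z)^-1.
Proof. by apply: complexI; rewrite fmorphV /= -!cabsE normfV. Qed.

Lemma cabsX (z : C) (n : nat) : cabs (z ^+ n) = cabs z ^+ n.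
Proof. by apply: complexI; rewrite rmorphXn /= -!cabsE normrX. Qed.

Lemma cabsD (z t : C) : cabs (z + t) <= cabs z + cabs t.
Proof. by rewrite -lecR rmorphD /= -!cabsE ler_normD. Qed.

Lemma cabs_eq0 (z : C) : (cabs z == 0) = (z == 0).
Proof. by rewrite -(inj_eq (@complexI R)) -cabsE normr_eq0. Qed.

Lemma cabs_real (x : R) : cabs x%:C = `|x|.
Proof. by rewrite /cabs /= expr0n /= addr0 sqrtr_sqr. Qed.

Lemma cabs_sqr (z : C) : cabs z ^+ 2 = Re z ^+ 2 + Im z ^+ 2.
Proof. by case: z => a b; rewrite sqr_sqrtr // addr_ge0 ?sqr_ge0. Qed.

Lemma ler_Re_cabs (z : C) : `|Re z| <= cabs z.
Proof.
by rewrite -(ler_pXn2r (n := 2)) ?nnegrE ?cabs_ge0 // cabs_sqr real_normK ?num_real //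
  lerDl sqr_ge0.
Qed.

Lemma ler_Im_cabs (z : C) : `|Im z| <= cabs z.
Proof.
by rewrite -(ler_pXn2r (n := 2)) ?nnegrE ?cabs_ge0 // cabs_sqr real_normK ?num_real //
  lerDr sqr_ge0.
Qed.

Lemma cabs_ler (z : C) : cabs z <= `|Re z| + `|Im z|.
Proof.
rewrite -(ler_pXn2r (n := 2)) ?nnegrE ?cabs_ge0 ?addr_ge0 // cabs_sqr sqrrD.
rewrite !real_normK ?num_real // addrAC lerDl.
by rewrite mulrn_wge0 // mulr_ge0.
Qed.

Lemma AC01P (f : R -> C) : AC01 f <-> ac (fun x => Re (f x)) /\ ac (fun x => Im (f x)).
Proof.
split => [acf|[ac1 ac2]].
  by split=> e e0; have [d d0 H] := acf e e0; exists d => // n a b ab tab sd;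
    apply: le_lt_trans (H n a b ab tab sd); apply: ler_sum => i _ /=;
    [rewrite -cReN -cReD ler_Re_cabs | rewrite -cImN -cImD ler_Im_cabs].
move=> e e0; have e20 : 0 < e / 2 by rewrite divr_gt0.
have [d1 d10 H1] := ac1 _ e20; have [d2 d20 H2] := ac2 _ e20.
exists (Num.min d1 d2); first by rewrite lt_min d10.
move=> n a b ab tab; rewrite lt_min => /andP[s1 s2].
have {}H1 := H1 n a b ab tab s1; have {}H2 := H2 n a b ab tab s2.
rewrite [e]splitr; apply: le_lt_trans (ltrD H1 H2); rewrite -big_split /=.
apply: ler_sum => i _; apply: le_trans (cabs_ler _) _.
by rewrite cReD cImD cReN cImN.
Qed.

Lemma AC01_eq (f g : R -> C) : (forall x, 0 <= x <= 1 -> f x = g x) -> AC01 f -> AC01 g.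
Proof.
move=> fg /AC01P[f1 f2]; apply/AC01P; split;
  [apply: ac_eq f1 | apply: ac_eq f2] => x xI /=; by rewrite fg.
Qed.

Lemma AC01_cst (c : C) : AC01 (fun=> c).
Proof. by apply/AC01P; split; exact: ac_cst. Qed.

Lemma AC01D (f g : R -> C) : AC01 f -> AC01 g -> AC01 (fun x => f x + g x).
Proof.
move=> /AC01P[f1 f2] /AC01P[g1 g2]; apply/AC01P; split.
- by apply: ac_eq (acD f1 g1) => x _ /=; rewrite cReD.
- by apply: ac_eq (acD f2 g2) => x _ /=; rewrite cImD.
Qed.

Lemma AC01M (f g : R -> C) : AC01 f -> AC01 g -> AC01 (fun x => f x * g x).
Proof.
move=> /AC01P[f1 f2] /AC01P[g1 g2]; apply/AC01P; split.
- apply: ac_eq (acD (acM f1 g1) (acZ (-1) (acM f2 g2))) => x _ /=.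
  by rewrite cReM mulN1r.
- by apply: ac_eq (acD (acM f1 g2) (acM f2 g1)) => x _ /=; rewrite cImM.
Qed.

Lemma AC01_bounded (f : R -> C) : AC01 f ->
  exists2 B, 0 < B & forall x, 0 <= x <= 1 -> cabs (f x) <= B.
Proof.
move=> /AC01P[f1 f2]; have [B B0 HB] := ac_bounded f1; have [D D0 HD] := ac_bounded f2.
exists (B + D); first exact: addr_gt0.
by move=> x xI; rewrite (le_trans (cabs_ler _)) // lerD ?HB ?HD.
Qed.

Lemma AC01V (f : R -> C) (c : R) : AC01 f -> 0 < c ->
  (forall x, 0 <= x <= 1 -> c <= cabs (f x)) -> AC01 (fun x => (f x)^-1).
Proof.
move=> /AC01P[f1 f2] c0 H.
have key x y : 0 <= x <= 1 -> 0 <= y <= 1 -> cabs ((f y)^-1 - (f x)^-1) <=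
   c ^- 2 * `|Re (f y) - Re (f x)| + c ^- 2 * `|Im (f y) - Im (f x)|.
  move=> xI yI; have nz t : 0 <= t <= 1 -> f t != 0.
    by move=> tI; rewrite -cabs_eq0 gt_eqF // (lt_le_trans c0) // H.
  have -> : (f y)^-1 - (f x)^-1 = - (f y - f x) * ((f y)^-1 * (f x)^-1).
    by field; rewrite !nz.
  rewrite -mulrDr -!cReN -!cImN -cReD -cImD cabsM cabsN mulrC.
  apply: ler_pM; rewrite ?cabs_ge0 ?cabs_ler // cabsM !cabsV expr2 invfM.
  by apply: ler_pM; rewrite ?invr_ge0 ?cabs_ge0 // lef_pV2 ?posrE ?H // (lt_le_trans c0) ?H.
apply/AC01P; split; apply: (ac_dominated (c1 := c ^- 2) (c2 := c ^- 2) f1 f2) => x y xI yI /=.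
- by rewrite (le_trans _ (key x y xI yI)) // -cReN -cReD ler_Re_cabs.
- by rewrite (le_trans _ (key x y xI yI)) // -cImN -cImD ler_Im_cabs.
Qed.

Definition cprim (f g : R -> C) : Prop :=
  AC01 f /\ {ae mu, forall x, unitJ x -> is_cderive f x (g x)}.

Lemma cprimP (f g : R -> C) : cprim f g <->
  primitive (fun x => Re (f x)) (fun x => Re (g x)) /\
  primitive (fun x => Im (f x)) (fun x => Im (g x)).
Proof.
split => [[/AC01P[f1 f2] d]|[[f1 d1] [f2 d2]]].
  by split; split => //; apply: (ae_imp d) => x H xJ; have [] := H xJ.
split; first exact/AC01P.
by apply: (ae_imp2 d1 d2) => x H1 H2 xJ; split; [exact: H1 | exact: H2].
Qed.

Lemma cprim_eq (f g f' g' : R -> C) : (forall x, 0 <= x <= 1 -> f x = g x) ->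
  {ae mu, forall x, unitJ x -> f' x = g' x} -> cprim f f' -> cprim g g'.
Proof.
move=> fg fg' /cprimP[p1 p2]; apply/cprimP; split;
 [apply: primitive_eq p1 | apply: primitive_eq p2] => /=.
- by move=> x xI /=; rewrite fg.
- by apply: (ae_imp fg') => x H xJ; rewrite H.
- by move=> x xI /=; rewrite fg.
- by apply: (ae_imp fg') => x H xJ; rewrite H.
Qed.

Lemma cprim_cst (c : C) : cprim (fun=> c) (fun=> 0).
Proof. by apply/cprimP; split; exact: primitive_cst. Qed.

Lemma cprimD (f g f' g' : R -> C) : cprim f f' -> cprim g g' ->
  cprim (fun x => f x + g x) (fun x => f' x + g' x).
Proof.
move=> /cprimP[f1 f2] /cprimP[g1 g2]; apply/cprimP; split.
- apply: primitive_eq (primitiveD f1 g1) => [x _|] /=; first by rewrite cReD.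
  by apply: aeW => x _ /=; rewrite cReD.
- apply: primitive_eq (primitiveD f2 g2) => [x _|] /=; first by rewrite cImD.
  by apply: aeW => x _ /=; rewrite cImD.
Qed.

Lemma cprimM (f g f' g' : R -> C) : cprim f f' -> cprim g g' ->
  cprim (fun x => f x * g x) (fun x => f' x * g x + f x * g' x).
Proof.
move=> /cprimP[f1 f2] /cprimP[g1 g2]; apply/cprimP; split.
- apply: primitive_eq (primitiveD (primitiveM f1 g1)
     (primitiveZ (-1) (primitiveM f2 g2))) => [x _|] /=; first by rewrite cReM mulN1r.
  by apply: aeW => x _ /=; rewrite cReD !cReM; ring.
- apply: primitive_eq (primitiveD (primitiveM f1 g2) (primitiveM f2 g1)) => [x _|] /=.
    by rewrite cImM.
  by apply: aeW => x _ /=; rewrite cImD !cImM; ring.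
Qed.

Lemma cprimZ (c : C) (f f' : R -> C) : cprim f f' ->
  cprim (fun x => c * f x) (fun x => c * f' x).
Proof.
move=> pf; apply: cprim_eq (cprimM (cprim_cst c) pf) => // .
by apply: aeW => x _; rewrite mul0r add0r.
Qed.

Lemma cprim_exists (g : R -> C) : inL1C g -> exists2 f, cprim f g & f 0 = 0.
Proof.
move=> [g1 g2]; have [f1 p1 f10] := primitive_exists g1; have [f2 p2 f20] := primitive_exists g2.
by exists (fun x => f1 x +i* f2 x); [apply/cprimP | rewrite f10 f20].
Qed.

Lemma cprim_is_cderive (f g : R -> C) : cprim f g -> AC01 g ->
  forall x, unitJ x -> is_cderive f x (g x).
Proof.
move=> /cprimP[p1 p2] /AC01P[g1 g2] x xJ; split.
- exact: (primitive_is_derive p1 g1 xJ).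
- exact: (primitive_is_derive p2 g2 xJ).
Qed.

Lemma inL1C_acM (f g : R -> C) : AC01 f -> inL1C g -> inL1C (fun x => f x * g x).
Proof.
move=> /AC01P[f1 f2] [g1 g2]; split.
- apply: inL1_ae (inL1D (inL1_acM f1 g1) (inL1_acM (acZ (-1) f2) g2)).
  by apply: aeW => x _ /=; rewrite cReM; ring.
- apply: inL1_ae (inL1D (inL1_acM f1 g2) (inL1_acM f2 g1)).
  by apply: aeW => x _ /=; rewrite cImM.
Qed.

Lemma inL1C_real (g : R -> R) : inL1 g -> inL1C (fun x => (g x)%:C).
Proof. by move=> g1; split => //; apply: inL1_ac; exact: ac_cst. Qed.

(** The zero function and f are almost everywhere derivatives of the same
    primitive F of f; hence F is constant, and its everywhere defined derivative
    f vanishes on the open interval. *)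
Lemma ac_ae0 (f : R -> R) : ac f -> {ae mu, forall x, unitJ x -> f x = 0} ->
  forall x, 0 <= x <= 1 -> f x = 0.
Proof.
move=> acf f0; have [F pF _] := primitive_exists (inL1_ac acf).
have pF0 : primitive F (fun=> 0) by apply: primitive_eq pF.
have fJ x : unitJ x -> f x = 0.
  move=> xJ; have dF := primitive_is_derive pF acf xJ.
  rewrite -(@derive_val _ _ _ _ _ _ _ dF); apply: derive_val.
  apply: near_eq_is_derive (is_derive_cst (F 0) x 1).
  apply: filterS (unitJ_near xJ) => y /unitJ_bounds yI.
  by rewrite (primitive0_cst pF0 yI).
move=> x xI; apply/eqP; rewrite -normr_eq0 eq_le normr_ge0 andbT.
apply/ler_addgt0Pl => e e0; rewrite addr0; have [d d0 H] := ac_uniform acf e0.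
(* Values at the end points are limits of values at points of the open
   interval, here a point between x and the midpoint 1/2. *)
pose t := Num.min (2^-1) (d / 2).
have [t0 t1 td] : [/\ 0 < t, t <= 2^-1 & t <= d / 2].
  by rewrite /t lt_min !ge_min !lexx orbT invr_gt0 divr_gt0 ?ltr0n.
have yJ : unitJ (x + t * (1/2 - x)).
  by rewrite /unitJ /= in_itv /=; case/andP: xI => x0 x1; apply/andP; split; nra.
have := H _ _ (unitJ_bounds yJ) xI; rewrite (fJ _ yJ) subr0 => /(_ _)/ltW; apply.
case/andP: xI => x0 x1; rewrite ltr_norml; apply/andP; split; nra.
Qed.

Lemma AC01_ae0 (f : R -> C) : AC01 f -> aeq f (fun=> 0) ->
  forall x, 0 <= x <= 1 -> f x = 0.
Proof.
move=> /AC01P[f1 f2] f0 x xI; apply: complexP.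
- by apply: (ac_ae0 f1 _ xI); apply: (ae_imp f0) => y H yJ; rewrite H.
- by apply: (ac_ae0 f2 _ xI); apply: (ae_imp f0) => y H yJ; rewrite H.
Qed.

End ComplexAC.

(** * Linear second order equations with integrable coefficients *)

Section LinearODE.
Context {R : realType}.
Local Notation C := R[i].
Local Notation mu := (@lebesgue_measure R).
Variables (p : R -> C) (w : R -> R).
Hypotheses (p_L1 : inL1C p) (w_L1 : inL1 w).
Hypothesis w_ge0 : {ae mu, forall x, unitJ x -> 0 <= w x}.

(** The equation (L - l) y = f solved for the second derivative, where
    p = b1 / b0, w = - 1 / b0, and [dy] stands for y'. *)
Definition sol (l : C) (f y dy : R -> C) : Prop :=
  cprim y dy /\ cprim dy (fun x => - (p x * dy x) - (w x)%:C * (l * y x + f x)).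

Lemma sol_comb (l a : C) (f y dy g z dz : R -> C) : sol l f y dy -> sol l g z dz ->
  sol l (fun x => a * f x + g x) (fun x => a * y x + z x) (fun x => a * dy x + dz x).
Proof.
move=> [y1 y2] [z1 z2]; split.
  exact: cprimD (cprimZ a y1) z1.
apply: cprim_eq (cprimD (cprimZ a y2) z2) => //.
by apply: aeW => x _; ring.
Qed.

(** A term of the equation moves from the left to the right-hand side: this is
    how solutions for different spectral parameters are compared. *)
Lemma sol_shift (l l' : C) (f y dy : R -> C) : sol l f y dy ->
  sol l' (fun x => f x + (l - l') * y x) y dy.
Proof.
move=> [y1 y2]; split => //; apply: cprim_eq y2 => //.
by apply: aeW => x _; ring.
Qed.

Lemma sol_eq (l : C) (f g y dy : R -> C) : aeq f g -> sol l f y dy -> sol l g y dy.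
Proof.
move=> fg [y1 y2]; split => //; apply: cprim_eq y2 => //.
by apply: (ae_imp fg) => x H xJ; rewrite H.
Qed.

Lemma sol0 (l : C) : sol l (fun=> 0) (fun=> 0) (fun=> 0).
Proof.
split; first exact: cprim_cst.
apply: cprim_eq (cprim_cst 0) => //.
by apply: aeW => x _; rewrite !mulr0 addr0 mulr0 subr0 oppr0.
Qed.

Lemma primitive_sqr (f g : R -> R) : primitive f g ->
  primitive (fun x => f x ^+ 2) (fun x => 2 * (f x * g x)).
Proof.
move=> pf; apply: primitive_eq (primitiveM pf pf) => [x _|] /=; first by rewrite expr2.
by apply: aeW => x _; ring.
Qed.

Lemma primitive_cabs2 (f g : R -> C) : cprim f g ->
  primitive (fun x => cabs (f x) ^+ 2)
    (fun x => 2 * (Re (f x) * Re (g x) + Im (f x) * Im (g x))).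
Proof.
move=> /cprimP[p1 p2].
apply: primitive_eq (primitiveD (primitive_sqr p1) (primitive_sqr p2)) => [x _|] /=.
  by rewrite cabs_sqr.
by apply: aeW => x _ /=; ring.
Qed.

Lemma inner_le (z t : C) : Re z * Re t + Im z * Im t <= cabs z * cabs t.
Proof.
apply: le_trans (ler_norm _) _.
rewrite -(ler_pXn2r (n := 2)) ?nnegrE ?mulr_ge0 ?cabs_ge0 //.
rewrite exprMn !cabs_sqr real_normK ?num_real //.
have := sqr_ge0 (Re z * Im t - Im z * Re t); nra.
Qed.

Lemma primitive_bounded (K k : R -> R) : primitive K k ->
  exists2 B, 0 < B & forall x, 0 <= x <= 1 -> `|K x| <= B.
Proof. by case=> /ac_bounded. Qed.

(** The product of Q and exp (- K) has a nonpositive derivative. *)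
Lemma gronwall_real (Q Q' k : R -> R) (K : R -> R) :
  primitive K k -> K 0 = 0 -> primitive Q Q' ->
  {ae mu, forall x, unitJ x -> Q' x <= k x * Q x} ->
  forall x, 0 <= x <= 1 -> Q x <= Q 0 * expR (K x).
Proof.
move=> pK K0 pQ QQ x /andP[x0 x1].
have pE := primitiveM pQ (primitive_expR (primitiveZ (-1) pK)).
have := primitive_nonincreasing pE _ (lexx 0) x0 x1.
rewrite /= K0 mulr0 expR0 mulr1 mulN1r expRN ler_pdivrMr ?expR_gt0 //; apply.
apply: (ae_imp QQ) => t H tJ.
have E0 := expR_gt0 (-1 * K t).
have := H tJ; nra.
Qed.

(** Gronwall's inequality for Q = |y|^2 + |y'|^2 + F^2.  Including the constant
    F^2 makes the differential inequality Q' <= k Q homogeneous.  The constant M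
    depends on l only through a bound on |l|, as needed for Taylor remainders, and
    the case of zero data and F = 0 is uniqueness. *)
Lemma sol_bound (L : R) : 0 <= L -> exists2 M, 0 < M &
  forall l f y dy F, cabs l <= L -> sol l f y dy ->
    (forall x, unitJ x -> cabs (f x) <= F) ->
  forall x, 0 <= x <= 1 -> cabs (y x) ^+ 2 + cabs (dy x) ^+ 2 <=
    M * (cabs (y 0) ^+ 2 + cabs (dy 0) ^+ 2 + F ^+ 2).
Proof.
move=> L0; pose k x := 1 + (2 * `|Re (p x)| + (L + 1) * w x).
have kL1 : inL1 k.
  apply: inL1D; first by apply: inL1_ac; exact: ac_cst.
  by apply: inL1D; apply: inL1Z => //; apply: inL1_norm; case: p_L1.
have [K pK K0] := primitive_exists kL1.
have [B B0 HB] := primitive_bounded pK.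
exists (expR B); first exact: expR_gt0.
move=> l f y dy F lL [y1 y2] fF x xI.
have pQ := primitiveD (primitiveD (primitive_cabs2 y1) (primitive_cabs2 y2))
   (primitive_cst (F ^+ 2)).
have := gronwall_real pK K0 pQ _ xI => /=.
set Qx := (_ + _ + _); set Q0 := (_ + _ + _).
have Q0_ge0 : 0 <= Q0 by rewrite /Q0 !addr_ge0 // sqr_ge0.
move=> H; have {H} : Qx <= Q0 * expR (K x).
  apply: H; apply: (ae_imp w_ge0) => t wt tJ; have {}wt := wt tJ.
  have {fF} := fF t tJ; move: (y t) (dy t) (f t) => a b c cF; rewrite addr0.
  have i1 := inner_le a b; have i2 := inner_le (- b) (l * a + c).
  rewrite cabsN !cReN !cImN in i2.
  have i3 : cabs (l * a + c) <= L * cabs a + F.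
    apply: le_trans (cabsD _ _) _; rewrite cabsM lerD //.
    by rewrite ler_wpM2r ?cabs_ge0.
  have b2 := cabs_sqr b.
  have a0 := cabs_ge0 a; have b0 := cabs_ge0 b.
  have F0 : 0 <= F by apply: le_trans cF; exact: cabs_ge0.
  have -> : Re b * Re (- (p t * b) - (w t)%:C * (l * a + c)) +
     Im b * Im (- (p t * b) - (w t)%:C * (l * a + c)) =
     - Re (p t) * cabs b ^+ 2 + w t * (- Re b * Re (l * a + c) - Im b * Im (l * a + c)).
    rewrite b2; move: (l * a + c) => d; rewrite !cReD !cImD !cReN !cImN !cReM !cImM /=; ring.
  have i4 : - Re b * Re (l * a + c) - Im b * Im (l * a + c) <= cabs b * (L * cabs a + F).
    by rewrite -mulNr; apply: le_trans i2 _; rewrite ler_wpM2l.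
  move: i4; set u := (_ - _) => i4.
  have i5 : - Re (p t) <= `|Re (p t)| by rewrite -normrN ler_norm.
  have i6 : - Re (p t) * cabs b ^+ 2 <= `|Re (p t)| * cabs b ^+ 2.
    by rewrite ler_wpM2r // sqr_ge0.
  have i7 : w t * u <= w t * (cabs b * (L * cabs a + F)) by rewrite ler_wpM2l.
  (* Expand and use 2 |a| |b| <= |a|^2 + |b|^2 and 2 |b| F <= |b|^2 + F^2. *)
  have i8 : 2 * (cabs b * (L * cabs a + F)) <=
      (L + 1) * (cabs a ^+ 2 + cabs b ^+ 2 + F ^+ 2).
    have s1 := sqr_ge0 (cabs a - cabs b); have s2 := sqr_ge0 (cabs b - F).
    have s3 : 0 <= L * (cabs a - cabs b) ^+ 2 by rewrite mulr_ge0.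
    have s4 : 0 <= L * F ^+ 2 by rewrite mulr_ge0 ?sqr_ge0.
    have s5 := sqr_ge0 (cabs a); move: s1 s2 s3 s4 s5; nra.
  have i9 : w t * (2 * (cabs b * (L * cabs a + F))) <=
      w t * ((L + 1) * (cabs a ^+ 2 + cabs b ^+ 2 + F ^+ 2)) by rewrite ler_wpM2l.
  have i10 : 2 * (cabs a * cabs b) <= cabs a ^+ 2 + cabs b ^+ 2 + F ^+ 2.
    have := sqr_ge0 (cabs a - cabs b); have := sqr_ge0 F; nra.
  have i11 : `|Re (p t)| * cabs b ^+ 2 <= `|Re (p t)| * (cabs a ^+ 2 + cabs b ^+ 2 + F ^+ 2).
    by rewrite ler_wpM2l //; have := sqr_ge0 (cabs a); have := sqr_ge0 F; lra.
  rewrite /k; lra.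
have KB : expR (K x) <= expR B by rewrite ler_expR (le_trans (ler_norm _)) ?HB.
move=> H; apply: (@le_trans _ _ Qx); first by rewrite /Qx lerDl sqr_ge0.
by apply: (le_trans H); rewrite mulrC ler_wpM2r.
Qed.

Lemma sol_unique (l : C) (f y dy z dz : R -> C) : sol l f y dy -> sol l f z dz ->
  y 0 = z 0 -> dy 0 = dz 0 ->
  forall x, 0 <= x <= 1 -> y x = z x /\ dy x = dz x.
Proof.
move=> sy sz yz0 dyz0 x xI.
have := sol_comb (-1) sy sz => s.
have {s} : sol l (fun=> 0) (fun x => -1 * y x + z x) (fun x => -1 * dy x + dz x).
  by apply: sol_eq s; apply: aeW => t _; rewrite mulN1r addNr.
have [M M0 HM] := sol_bound (cabs_ge0 l).
move=> /(HM l _ _ _ 0 (lexx _)) /(_ _ x xI).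
rewrite cabs0 => /(_ (fun _ _ => lexx _)).
rewrite yz0 dyz0 !mulN1r !addNr cabs0 expr0n /= !addr0 mulr0 => H.
have H1 := sqr_ge0 (cabs (- y x + z x)); have H2 := sqr_ge0 (cabs (- dy x + dz x)).
have E1 : cabs (- y x + z x) ^+ 2 = 0 by lra.
have E2 : cabs (- dy x + dz x) ^+ 2 = 0 by lra.
move/eqP: E1; rewrite expf_eq0 /= cabs_eq0 addrC subr_eq0 => /eqP ->.
by move/eqP: E2; rewrite expf_eq0 /= cabs_eq0 addrC subr_eq0 => /eqP ->.
Qed.

(** By Liouville's formula W' = - p W, the derivative of |W|^2 is at least
    - 2 |Re p| |W|^2, and W(0) = 1. *)
Lemma wronskian_bound (l : C) (y1 dy1 y2 dy2 : R -> C) :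
  sol l (fun=> 0) y1 dy1 -> sol l (fun=> 0) y2 dy2 ->
  y1 0 = 1 -> dy1 0 = 0 -> y2 0 = 0 -> dy2 0 = 1 ->
  exists2 c : R, 0 < c &
    forall x, 0 <= x <= 1 -> c <= cabs (y1 x * dy2 x - dy1 x * y2 x).
Proof.
move=> [y11 y12] [y21 y22] i1 i2 i3 i4.
pose W x := y1 x * dy2 x - dy1 x * y2 x.
have pW : cprim W (fun x => - (p x * W x)).
  apply: cprim_eq (cprimD (cprimM y11 y22) (cprimZ (-1) (cprimM y12 y21))) => [x _|].
    by rewrite mulN1r.
  by apply: aeW => x _; rewrite /W; ring.
have kL1 : inL1 (fun x => 2 * `|Re (p x)|).
  by apply: inL1Z; apply: inL1_norm; case: p_L1.
have [K pK K0] := primitive_exists kL1.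
have [B B0 HB] := primitive_bounded pK.
exists (expR (- (B / 2))); first exact: expR_gt0.
move=> x xI.
have pS := primitiveZ (-1) (primitive_cabs2 pW).
have := gronwall_real (primitiveZ (-1) pK) _ pS _ xI.
rewrite K0 mulr0 => /(_ erefl) /= H.
have {H} : -1 * cabs (W x) ^+ 2 <= -1 * cabs (W 0) ^+ 2 * expR (-1 * K x).
  apply: H; apply: aeW => t _.
  have -> : Re (W t) * Re (- (p t * W t)) + Im (W t) * Im (- (p t * W t)) =
     - Re (p t) * cabs (W t) ^+ 2.
    by rewrite cabs_sqr cReN cImN cReM cImM; ring.
  have := ler_norm (Re (p t)); have := sqr_ge0 (cabs (W t)); nra.
rewrite {2}/W i1 i2 i3 i4 mul0r subr0 mul1r cabs1 expr1n !mulN1r lerN2 => H.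
rewrite -(ler_pXn2r (n := 2)) ?nnegrE ?cabs_ge0 ?expR_ge0 //.
apply: le_trans H; rewrite -expRM_natl ler_expR.
have /andP[x0 x1] := xI; have := ler_norm (K x); have := HB x xI; lra.
Qed.

(** Variation of parameters: z = A y1 + D y2, where A' = w f y2 / W and
    D' = - w f y1 / W. *)
Lemma sol_exists (l : C) (y1 dy1 y2 dy2 f : R -> C) :
  sol l (fun=> 0) y1 dy1 -> sol l (fun=> 0) y2 dy2 ->
  y1 0 = 1 -> dy1 0 = 0 -> y2 0 = 0 -> dy2 0 = 1 -> AC01 f ->
  exists z dz, [/\ sol l f z dz, z 0 = 0 & dz 0 = 0].
Proof.
move=> s1 s2 i1 i2 i3 i4 acf; have [c c0 Wc] := wronskian_bound s1 s2 i1 i2 i3 i4.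
move: (s1) (s2) => [y11 y12] [y21 y22].
pose W x := y1 x * dy2 x - dy1 x * y2 x.
have acW : AC01 W.
  apply: (AC01_eq (f := fun x => y1 x * dy2 x + -1 * (dy1 x * y2 x))).
    by move=> x _; rewrite mulN1r.
  apply: AC01D; first exact: AC01M y11.1 y22.1.
  by apply: AC01M; [exact: AC01_cst | exact: AC01M y12.1 y21.1].
have acV : AC01 (fun x => (W x)^-1) by exact: AC01V acW c0 Wc.
pose g x := f x * (W x)^-1 * (w x)%:C.
have gL1 : inL1C g by apply: inL1C_acM (inL1C_real w_L1); exact: AC01M.
have [A pA A0] := cprim_exists (inL1C_acM y21.1 gL1).
have [D pD D0] := cprim_exists (inL1C_acM (AC01M (AC01_cst (-1)) y11.1) gL1).
exists (fun x => A x * y1 x + D x * y2 x), (fun x => A x * dy1 x + D x * dy2 x).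
split; rewrite ?A0 ?D0 ?mul0r ?addr0 //; split.
  apply: cprim_eq (cprimD (cprimM pA y11) (cprimM pD y21)) => //.
  by apply: aeW => x _; ring.
apply: cprim_eq (cprimD (cprimM pA y12) (cprimM pD y22)) => //.
apply: aeW => x xJ; rewrite /g.
have nz : W x != 0.
  by rewrite -cabs_eq0 gt_eqF // (lt_le_trans c0) // Wc // unitJ_bounds.
have -> : f x = W x * (f x / W x) by field.
rewrite [in RHS]/W; move: nz; rewrite /W => nz; field.
exact: nz.
Qed.

End LinearODE.

(** * Kernels of polynomial matrices acting by shifts *)

Section PolynomialKernel.
Variable F : fieldType.
Implicit Types (p q c a b m : {poly F}) (v : {poly F} * {poly F}).

(** The action of polynomials on polynomials for which X acts as the shift of
    coefficients towards lower degrees. *)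
Definition act p c : {poly F} := \sum_(k < size p) p`_k *: drop_poly k c.

Lemma coef_act n p c i : (size p <= n)%N ->
  (act p c)`_i = \sum_(k < n) p`_k * c`_(i + k).
Proof.
move=> pn; rewrite /act coef_sum (big_ord_widen_cond n xpredT
  (fun k => (p`_k *: drop_poly k c)`_i) pn) /= big_mkcond /=.
apply: eq_bigr => k _; case: ltnP => [kp|pk].
  by rewrite coefZ coef_drop_poly.
by rewrite nth_default ?mul0r.
Qed.

(** As c has only finitely many coefficients, high powers of X act as zero, and
    only a truncation of p matters. *)
Lemma coef_act_supp n p c i : (size c <= n)%N ->
  (act p c)`_i = \sum_(k < n) p`_k * c`_(i + k).
Proof.
move=> cn; rewrite (coef_act c i (leq_maxl (size p) n)).
rewrite [RHS](big_ord_widen _ (fun k => p`_k * c`_(i + k)) (leq_maxr (size p) n)).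
rewrite [RHS]big_mkcond /=; apply: eq_bigr => k _; case: ltnP => // nk.
by rewrite [c`__]nth_default ?mulr0 // (leq_trans cn) // (leq_trans nk) // leq_addl.
Qed.

Lemma actDl p q c : act (p + q) c = act p c + act q c.
Proof.
apply/polyP => i; rewrite coefD !(coef_act_supp _ _ (leqnn (size c))) -big_split /=.
by apply: eq_bigr => k _; rewrite coefD mulrDl.
Qed.

Lemma actZl s p c : act (s *: p) c = s *: act p c.
Proof.
apply/polyP => i; rewrite coefZ !(coef_act_supp _ _ (leqnn (size c))) mulr_sumr.
by apply: eq_bigr => k _; rewrite coefZ mulrA.
Qed.

Lemma actDr p c a : act p (c + a) = act p c + act p a.
Proof.
apply/polyP => i; rewrite coefD !(coef_act _ _ (leqnn (size p))) -big_split /=.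
by apply: eq_bigr => k _; rewrite coefD mulrDr.
Qed.

Lemma actZr p s c : act p (s *: c) = s *: act p c.
Proof.
apply/polyP => i; rewrite coefZ !(coef_act _ _ (leqnn (size p))) mulr_sumr.
by apply: eq_bigr => k _; rewrite coefZ mulrCA.
Qed.

Lemma act_mulX p c : act (p * 'X) c = act p (drop_poly 1 c).
Proof.
apply/polyP => i; rewrite (coef_act_supp _ _ (leqnSn (size c))).
rewrite big_ord_recl coefMX eqxx mul0r add0r.
rewrite (coef_act_supp (n := size c)); last by rewrite size_drop_poly leq_subr.
apply: eq_bigr => k _; rewrite coefMX /= coef_drop_poly.
by congr (_ * _`__); rewrite /bump /= ?add1n addnS addn1.
Qed.

(** The entries of the matrix are listed row by row and act through [act]. *)
Definition ker2 (m00 m01 m10 m11 : {poly F}) v : Prop :=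
  act m00 v.1 + act m01 v.2 = 0 /\ act m10 v.1 + act m11 v.2 = 0.

(** The kernel has dimension n.  The bound on the sizes goes with it because,
    on polynomials of size at most n, only the first n coefficients of the entries
    of the matrix act. *)
Definition ker2_basis (m00 m01 m10 m11 : {poly F}) (n : nat) : Prop :=
  exists e : 'I_n -> {poly F} * {poly F},
    [/\ forall i, [/\ ker2 m00 m01 m10 m11 (e i),
          (size (e i).1 <= n)%N & (size (e i).2 <= n)%N],
        forall s : 'I_n -> F, \sum_i s i *: e i = 0 -> forall i, s i = 0 &
        forall v, ker2 m00 m01 m10 m11 v -> exists s : 'I_n -> F, v = \sum_i s i *: e i].

Lemma pair_sumE (I : finType) (f : I -> {poly F} * {poly F}) :
  \sum_i f i = (\sum_i (f i).1, \sum_i (f i).2).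
Proof.
by rewrite [LHS]surjective_pairing; congr (_, _);
  [exact: (big_morph fst (fun _ _ => erefl) erefl) |
   exact: (big_morph snd (fun _ _ => erefl) erefl)].
Qed.

Lemma ker2_basis_swap (m00 m01 m10 m11 : {poly F}) n :
  ker2_basis m01 m00 m11 m10 n -> ker2_basis m00 m01 m10 m11 n.
Proof.
case=> e [eK eI eS]; pose sw v : {poly F} * {poly F} := (v.2, v.1).
have swsum (s : 'I_n -> F) (f : 'I_n -> _) :
    \sum_i s i *: sw (f i) = sw (\sum_i s i *: f i).
  by rewrite !pair_sumE.
have swK v : ker2 m00 m01 m10 m11 v -> ker2 m01 m00 m11 m10 (sw v).
  by case=> h1 h2; split; rewrite /= addrC.
have swK' v : ker2 m01 m00 m11 m10 v -> ker2 m00 m01 m10 m11 (sw v).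
  by case=> h1 h2; split; rewrite /= addrC.
exists (fun i => sw (e i)); split.
- by move=> i; have [ei s1 s2] := eK i; split => //; exact: swK'.
- by move=> s; rewrite swsum => -[h1 h2]; apply: eI; rewrite pair_sumE in h1 h2 *;
    rewrite /= in h1 h2; rewrite h1 h2.
- move=> v /swK/eS[s sv]; exists s; rewrite swsum -sv.
  by case: (v).
Qed.

(** The top coefficients of v form a vector in the kernel of the constant
    matrix M(0), which is invertible. *)
Lemma ker2_trivial (m00 m01 m10 m11 : {poly F}) v :
  m00`_0 * m11`_0 - m01`_0 * m10`_0 != 0 -> ker2 m00 m01 m10 m11 v -> v = 0.
Proof.
move=> d0; case: v => a b [/= h1 h2].
suff H n : (size a <= n)%N -> (size b <= n)%N -> a = 0 /\ b = 0.
  by have [-> ->] := H (maxn (size a) (size b)) (leq_maxl _ _) (leq_maxr _ _).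
elim: n => [|n IH] sa sb.
  by move: sa sb; rewrite !leqn0 !size_poly_eq0 => /eqP -> /eqP ->.
have top p c : (size c <= n.+1)%N -> (act p c)`_n = p`_0 * c`_n.
  move=> cn; rewrite (coef_act_supp _ _ cn) big_ord_recl /= addn0 big1 ?addr0 // => k _.
  by rewrite [c`__]nth_default ?mulr0 // (leq_trans cn) // /bump /= addnA addn1 ltnS leq_addr.
have {h1} h1 : m00`_0 * a`_n + m01`_0 * b`_n = 0 by rewrite -!top // -coefD h1 coef0.
have {h2} h2 : m10`_0 * a`_n + m11`_0 * b`_n = 0 by rewrite -!top // -coefD h2 coef0.
have an : a`_n = 0.
  apply: (mulfI d0); rewrite mulr0.
  have -> : (m00`_0 * m11`_0 - m01`_0 * m10`_0) * a`_n =
    m11`_0 * (m00`_0 * a`_n + m01`_0 * b`_n) - m01`_0 * (m10`_0 * a`_n + m11`_0 * b`_n).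
    by ring.
  by rewrite h1 h2 !mulr0 subr0.
have bn : b`_n = 0.
  apply: (mulfI d0); rewrite mulr0.
  have -> : (m00`_0 * m11`_0 - m01`_0 * m10`_0) * b`_n =
    m00`_0 * (m10`_0 * a`_n + m11`_0 * b`_n) - m10`_0 * (m00`_0 * a`_n + m01`_0 * b`_n).
    by ring.
  by rewrite h1 h2 !mulr0 subr0.
have shrink c : (size c <= n.+1)%N -> c`_n = 0 -> (size c <= n)%N.
  move=> cn c0; apply/leq_sizeP => j; rewrite leq_eqVlt => /orP[/eqP <- //|nj].
  by rewrite nth_default // (leq_trans cn).
by apply: IH; apply: shrink.
Qed.

(** Adding t times the second column to the first gives a column divisible by
    X.  In the corresponding coordinates (a, b - t a) the kernel of the matrix is
    the preimage, by the surjective map shifting the first coordinate, of the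
    kernel of the matrix in which the factor X has been removed.  The vector [u]
    spans the kernel of this map and [up] is a section of it. *)
Lemma ker2_basis_step (m00 m01 m10 m11 r0 r1 : {poly F}) (t : F) n :
  m00 + t *: m01 = r0 * 'X -> m10 + t *: m11 = r1 * 'X ->
  ker2_basis r0 m01 r1 m11 n -> ker2_basis m00 m01 m10 m11 n.+1.
Proof.
move=> E0 E1 [e [eK eI eS]].
pose up v : {poly F} * {poly F} := (v.1 * 'X, v.2 + t *: (v.1 * 'X)).
pose u : {poly F} * {poly F} := (1, t%:P).
have upsum (s : 'I_n -> F) (f : 'I_n -> _) :
    \sum_i s i *: up (f i) = up (\sum_i s i *: f i).
  rewrite !pair_sumE /up /=; congr (_, _).
    by rewrite mulr_suml; apply: eq_bigr => i _; rewrite -scalerAl.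
  rewrite mulr_suml scaler_sumr -big_split /=; apply: eq_bigr => i _.
  by rewrite scalerDr -scalerAl !scalerA mulrC.
have kerE v : ker2 m00 m01 m10 m11 v <-> ker2 r0 m01 r1 m11 (drop_poly 1 v.1, v.2 - t *: v.1).
  have key m (m' r : {poly F}) : m + t *: m' = r * 'X -> act m v.1 + act m' v.2 =
      act r (drop_poly 1 v.1) + act m' (v.2 - t *: v.1).
    move=> E; rewrite -act_mulX -E actDl actZl actDr -scaleN1r !actZr scaleN1r.
    by rewrite [RHS]addrACA subrr addr0.
  by rewrite /ker2 /= (key _ _ _ E0) (key _ _ _ E1).
have drop1X c : drop_poly 1 (c * 'X) = c.
  by apply/polyP => i; rewrite coef_drop_poly coefMX addn1.
exists (fun i => if unlift ord0 i is Some j then up (e j) else u).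
have sumE (s : 'I_n.+1 -> F) :
  \sum_i s i *: (if unlift ord0 i is Some j then up (e j) else u) =
  s ord0 *: u + up (\sum_i s (lift ord0 i) *: e i).
  rewrite big_ord_recl unlift_none -upsum; congr (_ + _).
  by apply: eq_bigr => i _; rewrite liftK.
split.
- move=> i; case: unliftP => [j _|_].
    have [ej s1 s2] := eK j; split.
    + by apply/kerE; rewrite /up /= drop1X addrK -surjective_pairing.
    + by rewrite /up /= (leq_trans (size_polyMleq _ _)) // size_polyX addn2.
    + rewrite /up /= (leq_trans (size_polyD _ _)) // geq_max leqW //=.
      rewrite (leq_trans (size_scale_leq _ _)) // (leq_trans (size_polyMleq _ _)) //.
      by rewrite size_polyX addn2.
  split.
  + apply/kerE; rewrite /u /= alg_polyC subrr.
    have -> : drop_poly 1 (1 : {poly F}) = 0.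
      by apply/polyP => i'; rewrite coef_drop_poly coef1 coef0 addn1.
    have a0 m : act m 0 = 0 by have := actZr m 0 0; rewrite !scale0r.
    by split; rewrite /= !a0 addr0.
  + by rewrite /u /= size_poly1.
  + by rewrite /u /= (leq_trans (size_polyC_leq1 _)).
- move=> s; rewrite sumE => -[h1 h2].
  move: h1 h2; set v := \sum_i _ => h1 h2.
  have s0 : s ord0 = 0.
    have := congr1 (fun q : {poly F} => q`_0) h1.
    by rewrite coefD coefZ coef1 coefMX coef0 /= mulr1 addr0.
  move: h1 h2; rewrite s0 !scale0r !add0r => h1.
  have v1 : v.1 = 0 by apply: (mulIf (negbT (polyX_eq0 F))) => //; rewrite mul0r.
  rewrite v1 mul0r scaler0 addr0 => v2.
  have v0 : v = 0 by rewrite [v]surjective_pairing v1 v2.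
  move=> i; case: (unliftP ord0 i) => [j ->|-> //]; exact: (eI (fun j => s (lift ord0 j))).
- move=> v /kerE/eS[s sv].
  exists (fun i => if unlift ord0 i is Some j then s j else (v.1)`_0).
  rewrite sumE unlift_none.
  have -> : \sum_i (if unlift ord0 (lift ord0 i) is Some j then s j else (v.1)`_0) *: e i =
      (drop_poly 1 v.1, v.2 - t *: v.1).
    by rewrite sv; apply: eq_bigr => i _; rewrite liftK.
  have v1E : v.1 = ((v.1)`_0)%:P + drop_poly 1 v.1 * 'X.
    apply/polyP => i; rewrite coefD coefC coefMX coef_drop_poly.
    by case: i => [|i] /=; rewrite ?addr0 ?add0r ?addn1.
  rewrite /up /u [LHS]surjective_pairing; congr (_, _) => /=.
    by rewrite alg_polyC.
  rewrite {2}v1E scalerDr -!mul_polyC; ring.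
Qed.

(** This amounts to a Smith normal form of the matrix over the local ring of
    polynomials at 0, reached by removing one factor X of the determinant at a
    time. *)
Lemma ker2_basisP n : forall m00 m01 m10 m11 q : {poly F},
  m00 * m11 - m01 * m10 = q * 'X^n -> q`_0 != 0 -> ker2_basis m00 m01 m10 m11 n.
Proof.
elim: n => [|n IH] m00 m01 m10 m11 q E q0.
  have d0 : m00`_0 * m11`_0 - m01`_0 * m10`_0 != 0.
    by rewrite -!coef0M -coefB E expr0 mulr1.
  exists (fun _ => 0); split; [by case | by move=> s _ [] | ].
  by move=> v /(ker2_trivial d0) ->; exists (fun _ => 0); rewrite big_ord0.
have step (a00 a01 a10 a11 r : {poly F}) (t : F) :
    a00 * a11 - a01 * a10 = r * 'X^(n.+1) -> r`_0 != 0 ->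
    (a00 + t *: a01)`_0 = 0 -> (a10 + t *: a11)`_0 = 0 -> ker2_basis a00 a01 a10 a11 n.+1.
  move=> aE r0 h0 h1.
  have divX (c : {poly F}) : c`_0 = 0 -> c = drop_poly 1 c * 'X.
    by move=> c0; apply/polyP => -[|i]; rewrite coefMX //= coef_drop_poly addn1.
  apply: (ker2_basis_step (divX _ h0) (divX _ h1)); apply: (IH _ _ _ _ r) => //.
  apply: (mulIf (negbT (polyX_eq0 F))) => //.
  rewrite -[RHS]mulrA -exprSr -aE mulrBl mulrAC -divX //.
  by rewrite -[X in _ - X = _]mulrA -divX // -!mul_polyC; ring.
have s0 : m00`_0 * m11`_0 - m01`_0 * m10`_0 = 0.
  by rewrite -!coef0M -coefB E exprS coef0M coef0M coefX mul0r mulr0.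
(* M(0) is singular: its first column is a multiple of its second one, unless
   the latter is zero, in which case the columns are exchanged. *)
have [c0|c0] := eqVneq m01`_0 0; last first.
  apply: (step _ _ _ _ _ (- m00`_0 / m01`_0) E q0); rewrite coefD coefZ; first by field.
  apply: (mulfI c0); rewrite mulr0 mulrDr.
  have -> : m01`_0 * (- m00`_0 / m01`_0 * m11`_0) = - (m00`_0 * m11`_0) by field.
  by move: s0 => /eqP; rewrite subr_eq0 => /eqP ->; rewrite subrr.
have [c1|c1] := eqVneq m11`_0 0; last first.
  apply: (step _ _ _ _ _ (- m10`_0 / m11`_0) E q0); rewrite coefD coefZ; last by field.
  move: s0; rewrite c0 mul0r subr0 mulr0 addr0 => /eqP.
  by rewrite mulf_eq0 (negbTE c1) orbF => /eqP.
apply: ker2_basis_swap; apply: (step _ _ _ _ (- q) 0).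
- by rewrite mulNr -E; ring.
- by rewrite coefN oppr_eq0.
- by rewrite scale0r addr0.
- by rewrite scale0r addr0.
Qed.

End PolynomialKernel.

(** * Boundary functionals and Jordan chains *)

Section BoundaryFunctionals.
Context {R : realType}.
Local Notation C := R[i].
Local Notation J := (unitJ : set (measurableTypeR R)).

(** The only properties of the boundary conditions that are used. *)
Definition bounded_functional (U : (R -> C) -> C) : Prop :=
  (forall a f g, AC01 f -> AC01 g -> U (fun x => a * f x + g x) = a * U f + U g) /\
  (exists B, forall f D, AC01 f -> (forall x, 0 <= x <= 1 -> cabs (f x) <= D) ->
     cabs (U f) <= B * D).

Definition nonlocal_bc (nu : probability (measurableTypeR R) R) (c : R) (y : R -> C) : C :=
  Cintegral nu y - y c.

Lemma Rintegral_ac_bound (nu : probability (measurableTypeR R) R) (f : R -> R) (D : R) :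
  nu unitJ = 1%E -> ac f -> (forall x, 0 <= x <= 1 -> `|f x| <= D) ->
  `|\int[nu]_(x in unitJ) f x| <= D.
Proof.
move=> nu1 acf fD.
have fin : (nu unitJ < +oo)%E by rewrite nu1 ltry.
have int_f := ac_integrable fin acf.
apply: le_trans (le_normr_Rintegral (@measurable_unitJ R) int_f) _.
have -> : D = \int[nu]_(x in unitJ) D.
  transitivity (D * fine (nu unitJ)); first by rewrite nu1 mulr1.
  exact: esym (Rintegral_cst nu (@measurable_unitJ R) D).
apply: le_Rintegral.
- exact: measurable_unitJ.
- by have := integrable_abse int_f.
- by apply: ac_integrable fin _; exact: ac_cst.
- by move=> x xJ; apply: fD; exact: unitJ_bounds.
Qed.

Lemma nonlocal_bc_functional (nu : probability (measurableTypeR R) R) (c : R) :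
  nu unitJ = 1%E -> 0 <= c <= 1 -> bounded_functional (nonlocal_bc nu c).
Proof.
move=> nu1 cI; have fin : (nu unitJ < +oo)%E by rewrite nu1 ltry.
have mJ := @measurable_unitJ R.
split => [a f g /AC01P[f1 f2] /AC01P[g1 g2]|].
  have If1 := ac_integrable fin f1; have If2 := ac_integrable fin f2.
  have Ig1 := ac_integrable fin g1; have Ig2 := ac_integrable fin g2.
  have comb (s t : R) (h1 h2 h3 : R -> R) : nu.-integrable unitJ (EFin \o h1) ->
      nu.-integrable unitJ (EFin \o h2) -> nu.-integrable unitJ (EFin \o h3) ->
      (\int[nu]_(x in unitJ) (s * h1 x + t * h2 x + h3 x))%R =
      s * (\int[nu]_(x in unitJ) h1 x)%R + t * (\int[nu]_(x in unitJ) h2 x)%R +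
      (\int[nu]_(x in unitJ) h3 x)%R.
    move=> i1 i2 i3.
    have z1 : nu.-integrable unitJ (EFin \o (fun x => s * h1 x)).
      by have := integrableZl mJ s i1.
    have z2 : nu.-integrable unitJ (EFin \o (fun x => t * h2 x)).
      by have := integrableZl mJ t i2.
    have z12 : nu.-integrable unitJ (EFin \o (fun x => s * h1 x + t * h2 x)).
      by have := integrableD mJ z1 z2.
    by rewrite RintegralD // RintegralD // !RintegralZl.
  rewrite /nonlocal_bc.
  have -> : Cintegral nu (fun x => a * f x + g x) = a * Cintegral nu f + Cintegral nu g.
    apply: complexP; rewrite /Cintegral /=.
      under eq_Rintegral do rewrite cReD cReM -mulNr.
      by rewrite comb // cReD cReM /= mulNr.
    under eq_Rintegral do rewrite cImD cImM.
    by rewrite comb // cImD cImM.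
  by ring.
exists 3 => f D acf fD; move/AC01P: (acf) => [f1 f2].
rewrite /nonlocal_bc (le_trans (cabsD _ _)) // cabsN.
have h1 := fD c cI.
have h2 : `|Re (Cintegral nu f)| <= D.
  by apply: Rintegral_ac_bound => // x xI; apply: le_trans (ler_Re_cabs _) (fD x xI).
have h3 : `|Im (Cintegral nu f)| <= D.
  by apply: Rintegral_ac_bound => // x xI; apply: le_trans (ler_Im_cabs _) (fD x xI).
have := cabs_ler (Cintegral nu f); lra.
Qed.

(** Boundedness by the supremum over [0, 1] makes the functional insensitive to
    values outside [0, 1]. *)
Lemma functional_eq (U : (R -> C) -> C) (f g : R -> C) : bounded_functional U ->
  AC01 f -> AC01 g -> (forall x, 0 <= x <= 1 -> f x = g x) -> U f = U g.
Proof.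
move=> [lin [B bnd]] acf acg fg.
have ac0 : AC01 (fun x => -1 * f x + g x).
  by apply: AC01D => //; apply: AC01M => //; exact: AC01_cst.
have := bnd _ 0 ac0; rewrite mulr0 lin // => H.
have {}H : cabs (-1 * U f + U g) <= 0.
  by apply: H => x xI; rewrite fg // mulN1r addNr cabs0.
have : cabs (-1 * U f + U g) == 0 by rewrite eq_le H cabs_ge0.
by rewrite cabs_eq0 mulN1r addrC subr_eq0 => /eqP.
Qed.

Lemma functional0 (U : (R -> C) -> C) : bounded_functional U -> U (fun=> 0) = 0.
Proof.
move=> [_ [B bnd]]; apply/eqP; rewrite -cabs_eq0 eq_le cabs_ge0 andbT.
have := bnd _ 0 (AC01_cst 0); rewrite mulr0; apply => x _; by rewrite cabs0.
Qed.

Lemma AC01_sum (n : nat) (a : nat -> C) (f : nat -> R -> C) : (forall k, AC01 (f k)) ->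
  AC01 (fun x => \sum_(k < n) a k * f k x).
Proof.
move=> acf; elim: n => [|n IH].
  by apply: AC01_eq (AC01_cst 0) => x _; rewrite big_ord0.
apply: AC01_eq (AC01D IH (AC01M (AC01_cst (a n)) (acf n))) => x _.
by rewrite big_ord_recr.
Qed.

Lemma functional_sum (U : (R -> C) -> C) (n : nat) (a : nat -> C) (f : nat -> R -> C) :
  bounded_functional U -> (forall k, AC01 (f k)) ->
  U (fun x => \sum_(k < n) a k * f k x) = \sum_(k < n) a k * U (f k).
Proof.
move=> bU acf; elim: n => [|n IH].
  have -> : (fun x => \sum_(k < 0) a k * f k x) = (fun=> 0).
    by apply/funext => x; rewrite big_ord0.
  by rewrite big_ord0 functional0.
rewrite big_ord_recr -IH /= addrC -bU.1 //; last exact: AC01_sum.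
by congr U; apply/funext => x; rewrite big_ord_recr addrC.
Qed.

End BoundaryFunctionals.

Section SpectralChains.
Context {R : realType}.
Local Notation C := R[i].
Variables (p : R -> C) (w : R -> R).
Hypotheses (p_L1 : inL1C p) (w_L1 : inL1 w).
Hypothesis w_ge0 : {ae (@lebesgue_measure R), forall x, unitJ x -> 0 <= w x}.

Definition zero_data_sol (l : C) (f z : R -> C) : Prop :=
  exists dz, [/\ sol p w l f z dz, z 0 = 0 & dz 0 = 0].

(** The functions z k are the Taylor coefficients, at the spectral parameter l,
    of the solution of the homogeneous equation with the initial data of z 0. *)
Definition jordan_chain (l : C) (z : nat -> R -> C) : Prop :=
  (exists dz, sol p w l (fun=> 0) (z 0%N) dz) /\
  forall k, zero_data_sol l (z k) (z k.+1).

Lemma sol_AC (l : C) (f y dy : R -> C) : sol p w l f y dy -> AC01 y.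
Proof. by case=> -[]. Qed.

Lemma jordan_chain_AC (l : C) (z : nat -> R -> C) (k : nat) : jordan_chain l z -> AC01 (z k).
Proof.
case=> -[dz s0] H; case: k => [|k]; first exact: sol_AC s0.
by have [dzk [/sol_AC]] := H k.
Qed.

(** A solution operator, obtained by choice, is iterated. *)
Lemma jordan_chain_exists (l : C) (y1 dy1 y2 dy2 y dy : R -> C) :
  sol p w l (fun=> 0) y1 dy1 -> sol p w l (fun=> 0) y2 dy2 ->
  y1 0 = 1 -> dy1 0 = 0 -> y2 0 = 0 -> dy2 0 = 1 ->
  sol p w l (fun=> 0) y dy -> exists2 z, jordan_chain l z & z 0%N = y.
Proof.
move=> s1 s2 i1 i2 i3 i4 s.
have /choice[G HG] : forall f : R -> C, exists z, AC01 f -> zero_data_sol l f z.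
  move=> f; have [acf|nf] := pselect (AC01 f); last by exists f.
  by have [z [dz H]] := sol_exists p_L1 w_L1 s1 s2 i1 i2 i3 i4 acf; exists z => _; exists dz.
exists (fun k => iter k G y) => //.
have acz k : AC01 (iter k G y).
  elim: k => [|k IH]; first exact: sol_AC s.
  by have [dz [/sol_AC]] := HG _ IH.
by split => [|k]; [exists dy | exact: HG].
Qed.

(** With t = l - l0, applying L - l to the sum of the t^k z_k telescopes and
    leaves a single term. *)
Lemma chain_partial_sum (l0 l : C) (z : nat -> R -> C) (dz0 : R -> C) (N : nat) :
  jordan_chain l0 z -> sol p w l0 (fun=> 0) (z 0%N) dz0 ->
  exists dS, [/\ sol p w l (fun x => - (l - l0) ^+ N.+1 * z N x)
      (fun x => \sum_(k < N.+1) (l - l0) ^+ k * z k x) dS,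
    \sum_(k < N.+1) (l - l0) ^+ k * z k 0 = z 0%N 0 & dS 0 = dz0 0].
Proof.
move=> [_ Hz] s0; elim: N => [|N [dS [sS S0 dS0]]].
  exists dz0; split => //; last by rewrite big_ord1 expr0 mul1r.
  have -> : (fun x => \sum_(k < 1) (l - l0) ^+ k * z k x) = z 0%N.
    by apply/funext => x; rewrite big_ord1 expr0 mul1r.
  apply: sol_eq (sol_shift l s0); apply: aeW => x _.
  by rewrite add0r expr1 opprB.
have [dz [sz zN dzN]] := Hz N.
exists (fun x => (l - l0) ^+ N.+1 * dz x + dS x); split.
- have -> : (fun x => \sum_(k < N.+2) (l - l0) ^+ k * z k x) =
     (fun x => (l - l0) ^+ N.+1 * z N.+1 x + \sum_(k < N.+1) (l - l0) ^+ k * z k x).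
    by apply/funext => x; rewrite big_ord_recr [LHS]addrC.
  apply: sol_eq (sol_comb _ (sol_shift l sz) sS); apply: aeW => x _.
  by rewrite [(l - l0) ^+ N.+2]exprS; ring.
- by rewrite big_ord_recr /= zN mulr0 addr0.
- by rewrite dzN mulr0 add0r.
Qed.

(** The remainder has zero initial data and satisfies the equation with
    right-hand side t^(N+1) z_N, by [chain_partial_sum], so that [sol_bound]
    applies. *)
Lemma chain_taylor (l0 : C) (z : nat -> R -> C) (dz0 : R -> C) (N : nat) :
  jordan_chain l0 z -> sol p w l0 (fun=> 0) (z 0%N) dz0 ->
  exists2 D, 0 <= D & forall l y dy, cabs (l - l0) <= 1 -> sol p w l (fun=> 0) y dy ->
    y 0 = z 0%N 0 -> dy 0 = dz0 0 -> forall x, 0 <= x <= 1 ->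
    cabs (y x - \sum_(k < N.+1) (l - l0) ^+ k * z k x) <= D * cabs (l - l0) ^+ N.+1.
Proof.
move=> zc s0.
have L0 : 0 <= cabs l0 + 1 by rewrite addr_ge0 ?cabs_ge0.
have [M M0 HM] := sol_bound p_L1 w_L1 w_ge0 L0.
have [B B0 HB] := AC01_bounded (jordan_chain_AC N zc).
exists ((M + 1) * B); first by rewrite mulr_ge0 ?addr_ge0 ?ltW.
move=> l y dy l1 sy y0 dy0 x xI.
have [dS [sS S0 dS0]] := chain_partial_sum l N zc s0.
have sd := sol_comb (-1) sS sy.
set t := l - l0 in l1 sS S0 sd *.
have lL : cabs l <= cabs l0 + 1.
  have -> : l = l0 + t by rewrite /t addrC subrK.
  by rewrite (le_trans (cabsD _ _)) // lerD2l.
have fB s : unitJ s -> cabs (-1 * (- t ^+ N.+1 * z N s) + 0) <= cabs t ^+ N.+1 * B.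
  move=> sJ; rewrite addr0 mulN1r mulNr opprK cabsM cabsX ler_wpM2l ?exprn_ge0 ?cabs_ge0 //.
  by apply: HB; exact: unitJ_bounds.
have := HM _ _ _ _ _ lL sd fB x xI.
rewrite S0 dS0 y0 dy0 !mulN1r !addNr cabs0 expr0n /= !add0r => H.
rewrite addrC -(ler_pXn2r (n := 2)) ?nnegrE ?cabs_ge0 //; last first.
  by rewrite !mulr_ge0 ?exprn_ge0 ?cabs_ge0 ?addr_ge0 // ltW.
have q0 := sqr_ge0 (cabs (- dS x + dy x)).
apply: (@le_trans _ _ (M * (cabs t ^+ N.+1 * B) ^+ 2)); first by lra.
rewrite -mulrA [B * _]mulrC [leRHS]exprMn ler_wpM2r ?sqr_ge0 //; nra.
Qed.

End SpectralChains.

Section VanishingOrder.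
Context {R : realType}.
Local Notation C := R[i].

(** The estimate holds on the whole unit disc, where Taylor remainders are
    bounded uniformly; no limit is involved. *)
Definition isO (n : nat) (f : C -> C) : Prop :=
  exists2 D : R, 0 <= D & forall t, cabs t <= 1 -> cabs (f t) <= D * cabs t ^+ n.

Lemma isOD n f g : isO n f -> isO n g -> isO n (fun t => f t + g t).
Proof.
move=> [D D0 HD] [E E0 HE]; exists (D + E); first exact: addr_ge0.
by move=> t t1; rewrite mulrDl (le_trans (cabsD _ _)) // lerD ?HD ?HE.
Qed.

Lemma isON n f : isO n f -> isO n (fun t => - f t).
Proof. by move=> [D D0 HD]; exists D => // t t1; rewrite cabsN HD. Qed.

Lemma isOM n m f g : isO n f -> isO m g -> isO (n + m) (fun t => f t * g t).
Proof.
move=> [D D0 HD] [E E0 HE]; exists (D * E); first exact: mulr_ge0.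
by move=> t t1; rewrite cabsM exprD mulrACA ler_pM ?cabs_ge0 ?HD ?HE.
Qed.

Lemma isO_eq n f g : f =1 g -> isO n f -> isO n g.
Proof. by move=> fg [D D0 HD]; exists D => // t t1; rewrite -fg HD. Qed.

Lemma isO_horner (P : {poly C}) : isO 0 (fun t => P.[t]).
Proof.
elim/poly_ind: P => [|P c IH].
  by exists 0 => // t _; rewrite horner0 cabs0 mul0r.
have O1 : isO 0 (fun t : C => t) by exists 1 => // t t1; rewrite expr0 mulr1.
have Oc : isO 0 (fun _ : C => c) by exists (cabs c) => [|t _]; rewrite ?cabs_ge0 // expr0 mulr1.
by apply: isO_eq (isOD (isOM IH O1) Oc) => t; rewrite hornerMXaddC.
Qed.

(** The value at t = 0 is left out because divisions by t precede the use of
    this lemma. *)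
Lemma poly_limit0 (P : {poly C}) (c : C) :
  (forall e, 0 < e -> exists2 d, 0 < d &
    forall t, 0 < cabs t < d -> cabs (P.[t] - c) <= e) -> P`_0 = c.
Proof.
move=> H; apply/eqP; rewrite -subr_eq0 -cabs_eq0 eq_le cabs_ge0 andbT.
apply/ler_addgt0Pl => e e0; rewrite addr0; have e20 : 0 < e / 2 by rewrite divr_gt0.
have [d d0 Hd] := H _ e20.
have PE t : P.[t] = P`_0 + t * (drop_poly 1 P).[t].
  have {1}-> : P = (drop_poly 1 P) * 'X + (P`_0)%:P.
    by apply/polyP => i; rewrite coefD coefMX coefC coef_drop_poly; case: i => [|i] /=;
      rewrite ?add0r ?addr0 ?addn1.
  by rewrite hornerMXaddC addrC mulrC.
have [D D0 HD] := isO_horner (drop_poly 1 P).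
pose s := Num.min 1 (Num.min (d / 2) (e / 2 / (D + 1))).
have D1 : 0 < D + 1 by rewrite ltr_wpDl.
have s0 : 0 < s by rewrite /s !lt_min ltr01 !divr_gt0.
have [s1 sd se] : [/\ s <= 1, s <= d / 2 & s <= e / 2 / (D + 1)].
  by rewrite /s !ge_min !lexx !orbT.
have cs : cabs s%:C = s by apply: complexI; rewrite -cabsE ger0_norm // ler0c ltW.
have := Hd s%:C; rewrite cs s0 => /(_ ltac:(lra)) h1.
have := HD s%:C; rewrite cs expr0 mulr1 => /(_ s1) h2.
have -> : P`_0 - c = (P.[s%:C] - c) + - (s%:C * (drop_poly 1 P).[s%:C]) by rewrite PE; ring.
apply: (le_trans (cabsD _ _)); rewrite cabsN cabsM cs.
have h3 : s * cabs (drop_poly 1 P).[s%:C] <= s * D by rewrite ler_wpM2l // ltW.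
move: se; rewrite ler_pdivlMr // => se; nra.
Qed.

(** Induction on n: for n > 0, both terms of the estimate show that P tends to 0
    at 0, so that a factor t can be divided out. *)
Lemma poly_order (g : C -> C) (n : nat) : forall P : {poly C},
  (forall e, 0 < e -> exists2 d, 0 < d & forall t, cabs t < d -> cabs (g t - g 0) <= e) ->
  (exists D, exists2 d, 0 < d & forall t, 0 < cabs t < d ->
     cabs (P.[t] - t ^+ n * g t) <= D * cabs t ^+ n.+1) ->
  exists2 Q, P = Q * 'X^n & Q`_0 = g 0.
Proof.
move=> P cg; elim: n P => [|n IH] P [D [d d0 HD]].
  exists P; first by rewrite expr0 mulr1.
  apply: poly_limit0 => e e0; have e20 : 0 < e / 2 by rewrite divr_gt0.
  have [d' d'0 Hd'] := cg _ e20.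
  have D1 : 0 < `|D| + 1 by rewrite ltr_wpDl.
  exists (Num.min d (Num.min d' (e / 2 / (`|D| + 1)))).
    by rewrite !lt_min d0 d'0 !divr_gt0.
  move=> t; rewrite !lt_min => /andP[t0 /and3P[td td' te]].
  have h1 := HD t; rewrite t0 td expr0 mul1r expr1 in h1; have {}h1 := h1 isT.
  have h2 := Hd' t td'.
  have -> : P.[t] - g 0 = (P.[t] - g t) + (g t - g 0) by ring.
  apply: (le_trans (cabsD _ _)).
  have h3 : D * cabs t <= `|D| * cabs t by rewrite ler_wpM2r ?cabs_ge0 // ler_norm.
  move: te; rewrite ltr_pdivlMr // => te; lra.
have P0 : P`_0 = 0.
  apply: poly_limit0 => e e0; have [d' d'0 Hd'] := cg _ (ltr01 : 0 < 1 :> R).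
  pose B := `|D| + (cabs (g 0) + 1).
  have B0 : 0 < B by rewrite /B ltr_wpDl ?ltr_wpDl ?cabs_ge0.
  exists (Num.min 1 (Num.min d (Num.min d' (e / B)))).
    by rewrite !lt_min ltr01 d0 d'0 !divr_gt0.
  move=> t; rewrite !lt_min => /andP[t0 /and4P[t1 td td' te]].
  have h1 := HD t; rewrite t0 td in h1; have {}h1 := h1 isT.
  have h2 := Hd' t td'.
  have h3 : cabs (g t) <= cabs (g 0) + 1.
    have -> : g t = g 0 + (g t - g 0) by ring.
    by rewrite (le_trans (cabsD _ _)) // lerD2l.
  have -> : P.[t] - 0 = (P.[t] - t ^+ n.+1 * g t) + t ^+ n.+1 * g t by ring.
  apply: (le_trans (cabsD _ _)).
  have tn k : cabs t ^+ k.+1 <= cabs t.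
    by rewrite exprS ler_piMr ?cabs_ge0 // exprn_ile1 ?cabs_ge0 // ltW.
  have h4 : D * cabs t ^+ n.+2 <= `|D| * cabs t.
    apply: (@le_trans _ _ (`|D| * cabs t ^+ n.+2)); last by rewrite ler_wpM2l.
    by rewrite ler_wpM2r ?exprn_ge0 ?cabs_ge0 // ler_norm.
  have h5 : cabs (t ^+ n.+1 * g t) <= cabs t * (cabs (g 0) + 1).
    by rewrite cabsM cabsX ler_pM ?exprn_ge0 ?cabs_ge0.
  move: te; rewrite ltr_pdivlMr // /B => te; lra.
have PX : P = drop_poly 1 P * 'X.
  by apply/polyP => -[|i]; rewrite coefMX //= coef_drop_poly addn1.
have [|Q QE Q0] := IH (drop_poly 1 P).
  exists D; exists d => // t /andP[t0 td].
  have := HD t; rewrite t0 td => /(_ isT); rewrite {1}PX hornerMX.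
  have -> : (drop_poly 1 P).[t] * t - t ^+ n.+1 * g t =
     t * ((drop_poly 1 P).[t] - t ^+ n * g t) by rewrite exprS; ring.
  by rewrite cabsM [_ ^+ n.+2]exprS mulrCA ler_pM2l.
by exists Q => //; rewrite PX QE -mulrA -exprSr.
Qed.

End VanishingOrder.

(** * Solutions of the iterated equation *)

Section ChainCombinations.
Context {R : realType}.
Local Notation C := R[i].
Variables (p : R -> C) (w : R -> R) (l0 : C).

Definition comb (z : nat -> R -> C) (a : {poly C}) : R -> C :=
  fun x => \sum_(k < size a) a`_k * z k x.

Lemma combE (z : nat -> R -> C) (a : {poly C}) (n : nat) : (size a <= n)%N ->
  comb z a = (fun x => \sum_(k < n) a`_k * z k x).
Proof.
move=> an; apply/funext => x; rewrite /comb (big_ord_widen _ (fun k => a`_k * z k x) an).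
rewrite big_mkcond /=; apply: eq_bigr => k _; case: ltnP => // ak.
by rewrite nth_default ?mul0r.
Qed.

Lemma comb_linear (z : nat -> R -> C) (s : C) (a b : {poly C}) (x : R) :
  comb z (s *: a + b) x = s * comb z a x + comb z b x.
Proof.
pose n := maxn (size a) (size b).
have sn : (size (s *: a + b)%R <= n)%N.
  rewrite (leq_trans (size_polyD _ _)) // geq_max leq_maxr andbT.
  by rewrite (leq_trans (size_scale_leq _ _)) // leq_maxl.
rewrite (combE z sn) (combE z (leq_maxl _ _ : (size a <= n)%N)).
rewrite (combE z (leq_maxr _ _ : (size b <= n)%N)) mulr_sumr -big_split /=.
by apply: eq_bigr => k _; rewrite coefD coefZ mulrDl mulrA.
Qed.

(** Applying L - l0 to a combination of a chain shifts its coefficients. *)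
Lemma comb_sol (z : nat -> R -> C) (dz0 : R -> C) (a : {poly C}) :
  jordan_chain p w l0 z -> sol p w l0 (fun=> 0) (z 0%N) dz0 ->
  exists d, [/\ sol p w l0 (comb z (drop_poly 1 a)) (comb z a) d,
    comb z a 0 = a`_0 * z 0%N 0 & d 0 = a`_0 * dz0 0].
Proof.
move=> [_ Hz] s0.
suff /(_ (size a)) H n : exists d,
    [/\ sol p w l0 (fun x => \sum_(k < n) a`_k.+1 * z k x)
          (fun x => \sum_(k < n.+1) a`_k * z k x) d,
      \sum_(k < n.+1) a`_k * z k 0 = a`_0 * z 0%N 0 & d 0 = a`_0 * dz0 0].
  have [d [sd d0 d1]] := H; exists d; rewrite (combE z (leqnSn (size a))).
  have sd1 : (size (drop_poly 1 a) <= size a)%N by rewrite size_drop_poly leq_subr.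
  rewrite (combE z sd1); split => //; apply: sol_eq sd; apply: aeW => x _.
  by apply: eq_bigr => k _; rewrite coef_drop_poly addn1.
elim: n => [|n [d [sd d0 d1]]].
  exists (fun x => a`_0 * dz0 x + 0); split; last by rewrite addr0.
    have -> : (fun x => \sum_(k < 1) a`_k * z k x) = (fun x => a`_0 * z 0%N x + 0).
      by apply/funext => x; rewrite big_ord1 addr0.
    apply: sol_eq (sol_comb a`_0 s0 (sol0 p w l0)); apply: aeW => x _.
    by rewrite big_ord0 mulr0 addr0.
  by rewrite big_ord1.
have [dz [sz z0 dz1]] := Hz n.
exists (fun x => a`_n.+1 * dz x + d x); split.
- have -> : (fun x => \sum_(k < n.+2) a`_k * z k x) =
     (fun x => a`_n.+1 * z n.+1 x + \sum_(k < n.+1) a`_k * z k x).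
    by apply/funext => x; rewrite big_ord_recr [LHS]addrC.
  apply: sol_eq (sol_comb a`_n.+1 sz sd); apply: aeW => x _.
  by rewrite big_ord_recr [RHS]addrC.
- by rewrite big_ord_recr /= d0 z0 mulr0 addr0.
- by rewrite dz1 mulr0 add0r.
Qed.

Lemma functional_comb (U : (R -> C) -> C) (z : nat -> R -> C) (a : {poly C}) (n : nat) :
  bounded_functional U -> (forall k, AC01 (z k)) -> (size a <= n)%N ->
  U (comb z a) = \sum_(k < n) a`_k * U (z k).
Proof. by move=> bU acz an; rewrite (combE z an) functional_sum. Qed.

(** The values of U on the successive images of a combination under L - l0 are
    the coefficients of the polynomial obtained by letting the generating
    polynomial of the U (z k) act. *)
Lemma functional_comb_act (U : (R -> C) -> C) (z : nat -> R -> C) (a : {poly C})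
    (n m : nat) : bounded_functional U -> (forall k, AC01 (z k)) -> (size a <= n)%N ->
  U (comb z (drop_poly m a)) = (act (\poly_(k < n) U (z k)) a)`_m.
Proof.
move=> bU acz an; rewrite (functional_comb bU acz (n := n)); last first.
  by rewrite size_drop_poly (leq_trans (leq_subr _ _)).
rewrite (coef_act_supp _ _ an); apply: eq_bigr => k _.
by rewrite coef_drop_poly coef_poly ltn_ord mulrC addnC.
Qed.

End ChainCombinations.

Section GeneralizedSolutions.
Context {R : realType}.
Local Notation C := R[i].
Local Notation mu := (@lebesgue_measure R).
Variables (p : R -> C) (w : R -> R) (l0 : C).
Hypotheses (p_L1 : inL1C p) (w_L1 : inL1 w).
Hypothesis w_gt0 : {ae mu, forall x, unitJ x -> 0 < w x}.
Variables (z1 z2 : nat -> R -> C) (dy1 dy2 : R -> C).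
Hypotheses (zc1 : jordan_chain p w l0 z1) (zc2 : jordan_chain p w l0 z2).
Hypotheses (s1 : sol p w l0 (fun=> 0) (z1 0%N) dy1) (s2 : sol p w l0 (fun=> 0) (z2 0%N) dy2).
Hypotheses (z10 : z1 0%N 0 = 1) (dy10 : dy1 0 = 0) (z20 : z2 0%N 0 = 0) (dy20 : dy2 0 = 1).

Let w_ge0 : {ae mu, forall x, unitJ x -> 0 <= w x}.
Proof. by apply: (ae_imp w_gt0) => x H /H /ltW. Qed.

(** Here v.1 lists the coefficients on the chain of y1, and v.2 those on the
    chain of y2. *)
Definition Phi (v : {poly C} * {poly C}) : R -> C :=
  fun x => comb z1 v.1 x + comb z2 v.2 x.

Definition drop2 (m : nat) (v : {poly C} * {poly C}) : {poly C} * {poly C} :=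
  (drop_poly m v.1, drop_poly m v.2).

Lemma Phi_linear (s : C) (u v : {poly C} * {poly C}) (x : R) :
  Phi (s *: u + v) x = s * Phi u x + Phi v x.
Proof. by rewrite /Phi /= !comb_linear; ring. Qed.

Lemma Phi0 (x : R) : Phi 0 x = 0.
Proof. by rewrite /Phi /comb size_poly0 !big_ord0 addr0. Qed.

Lemma Phi_sum (n : nat) (s : 'I_n -> C) (e : 'I_n -> {poly C} * {poly C}) (x : R) :
  Phi (\sum_i s i *: e i) x = \sum_i s i * Phi (e i) x.
Proof.
elim/big_ind2: _ => [|u a v b <- <-|i _]; first exact: Phi0.
  by rewrite -[a]scale1r Phi_linear mul1r scale1r.
by rewrite -[_ *: _]addr0 Phi_linear Phi0 addr0.
Qed.

Lemma Phi_sol (v : {poly C} * {poly C}) : exists d,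
  [/\ sol p w l0 (Phi (drop2 1 v)) (Phi v) d, Phi v 0 = v.1`_0 & d 0 = v.2`_0].
Proof.
have [d1 [sd1 a1 b1]] := comb_sol v.1 zc1 s1.
have [d2 [sd2 a2 b2]] := comb_sol v.2 zc2 s2.
exists (fun x => 1 * d1 x + d2 x); split.
- have -> : Phi v = (fun x => 1 * comb z1 v.1 x + comb z2 v.2 x).
    by apply/funext => x; rewrite mul1r.
  by apply: sol_eq (sol_comb 1 sd1 sd2); apply: aeW => x _; rewrite mul1r.
- by rewrite /Phi a1 a2 z10 z20 mulr1 mulr0 addr0.
- by rewrite b1 b2 dy10 dy20 mulr0 mulr0 add0r mulr1.
Qed.

Lemma Phi_AC (v : {poly C} * {poly C}) : AC01 (Phi v).
Proof. by have [d [/sol_AC]] := Phi_sol v. Qed.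

(** Prepending the initial data of y to the coefficients gives a combination
    solving the same initial value problem. *)
Lemma sol_Phi (v : {poly C} * {poly C}) (y dy : R -> C) : sol p w l0 (Phi v) y dy ->
  exists2 v', drop2 1 v' = v & forall x, 0 <= x <= 1 -> y x = Phi v' x.
Proof.
move=> sy; pose v' := (v.1 * 'X + (y 0)%:P, v.2 * 'X + (dy 0)%:P).
have dv : drop2 1 v' = v.
  rewrite /drop2 [RHS]surjective_pairing; congr (_, _);
    by apply/polyP => i; rewrite coef_drop_poly coefD coefMX coefC addn1 /= addr0.
exists v' => // x xI.
have [d [sd v0 d0]] := Phi_sol v'; rewrite dv in sd.
suff [] : y x = Phi v' x /\ dy x = d x by [].
apply: (sol_unique p_L1 w_L1 w_ge0 sy sd) => //.
- by rewrite v0 /= coefD coefMX coefC /= add0r.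
- by rewrite d0 /= coefD coefMX coefC /= add0r.
Qed.

Lemma cprim_derive_unique (f g h : R -> C) : cprim f g -> cprim f h -> aeq g h.
Proof.
move=> [_ dg] [_ dh]; apply: (ae_imp2 dg dh) => x H1 H2 xJ.
have [a1 a2] := H1 xJ; have [c1 c2] := H2 xJ.
apply: complexP.
- by rewrite -(@derive_val _ _ _ _ _ _ _ a1) (@derive_val _ _ _ _ _ _ _ c1).
- by rewrite -(@derive_val _ _ _ _ _ _ _ a2) (@derive_val _ _ _ _ _ _ _ c2).
Qed.

(** If Phi v vanishes, so do its derivative and, as w > 0, its image under
    L - l0, which is the combination with shifted coefficients.  The initial data
    give the lowest coefficients, and induction the others. *)
Lemma Phi_injective (v : {poly C} * {poly C}) : aeq (Phi v) (fun=> 0) -> v = 0.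
Proof.
suff H n : forall v : {poly C} * {poly C}, (size v.1 <= n)%N ->
    (size v.2 <= n)%N -> aeq (Phi v) (fun=> 0) -> v = 0.
  exact: (H (maxn (size v.1) (size v.2)) _ (leq_maxl _ _) (leq_maxr _ _)).
elim: n => [|n IH] {}v n1 n2 v0.
  move: n1 n2; rewrite !leqn0 !size_poly_eq0 => /eqP e1 /eqP e2.
  by rewrite [v]surjective_pairing e1 e2.
have [d [[sd1 sd2] Pv0 dv0]] := Phi_sol v.
have P0 := AC01_ae0 (Phi_AC v) v0.
have d_ae : aeq d (fun=> 0).
  apply: cprim_derive_unique sd1 _; apply: cprim_eq (cprim_cst 0) => [x xI|].
    by rewrite P0.
  exact: aeW.
have d0 := AC01_ae0 sd2.1 d_ae.
have rhs_ae : aeq (fun x => - (p x * d x) - (w x)%:C * (l0 * Phi v x + Phi (drop2 1 v) x))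
    (fun=> 0).
  apply: cprim_derive_unique sd2 _; apply: cprim_eq (cprim_cst 0) => [x xI|].
    by rewrite d0.
  exact: aeW.
have drop0 : drop2 1 v = 0.
  apply: IH; rewrite ?size_drop_poly ?leq_subLR //.
  apply: (ae_imp2 rhs_ae w_gt0) => x H wx xJ.
  have := H xJ; rewrite d0 ?unitJ_bounds // P0 ?unitJ_bounds // !mulr0 oppr0 !add0r.
  move/eqP; rewrite oppr_eq0 mulf_eq0 => /orP[|/eqP //].
  by have := wx xJ; rewrite lt_def => /andP[/negbTE wn _]; rewrite -cabs_eq0 cabs_real normr_eq0 wn.
have coef0v (a : {poly C}) : drop_poly 1 a = 0 -> a`_0 = 0 -> a = 0.
  move=> da a0; apply/polyP => -[|i]; rewrite coef0 //.
  by rewrite -addn1 -coef_drop_poly da coef0.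
have I0 : 0 <= (0 : R) <= 1 by rewrite lexx ler01.
move: drop0; rewrite /drop2 => -[e1 e2].
have v1 : v.1 = 0 by apply: coef0v e1 _; rewrite -Pv0 P0.
have v2 : v.2 = 0 by apply: coef0v e2 _; rewrite -dv0 d0.
by rewrite [LHS]surjective_pairing v1 v2.
Qed.

Section Boundary.
Variables (U0 U1 : (R -> C) -> C).
Hypotheses (bU0 : bounded_functional U0) (bU1 : bounded_functional U1).

(** All the images of Phi v under powers of L - l0 satisfy the boundary
    conditions. *)
Definition admissible (v : {poly C} * {poly C}) : Prop :=
  forall m, U0 (Phi (drop2 m v)) = 0 /\ U1 (Phi (drop2 m v)) = 0.

Definition bc_poly (U : (R -> C) -> C) (z : nat -> R -> C) (N : nat) : {poly C} :=
  \poly_(k < N) U (z k).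

Lemma admissibleP (v : {poly C} * {poly C}) (N : nat) :
  (size v.1 <= N)%N -> (size v.2 <= N)%N ->
  admissible v <-> ker2 (bc_poly U0 z1 N) (bc_poly U0 z2 N)
                        (bc_poly U1 z1 N) (bc_poly U1 z2 N) v.
Proof.
move=> n1 n2.
have ac1 k : AC01 (z1 k) by exact: jordan_chain_AC zc1.
have ac2 k : AC01 (z2 k) by exact: jordan_chain_AC zc2.
have key U : bounded_functional U -> forall m, U (Phi (drop2 m v)) =
   (act (bc_poly U z1 N) v.1 + act (bc_poly U z2 N) v.2)`_m.
  move=> bU m; rewrite coefD -!functional_comb_act // -[X in X + _]mul1r -bU.1.
  - by congr U; apply/funext => x; rewrite mul1r.
  - by apply: AC01_eq (AC01_sum (size (drop_poly m v.1)) (fun k => (drop_poly m v.1)`_k) ac1).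
  - by apply: AC01_eq (AC01_sum (size (drop_poly m v.2)) (fun k => (drop_poly m v.2)`_k) ac2).
split => [adm|[k0 k1] m]; last by rewrite !key // k0 k1 coef0.
by split; apply/polyP => m; rewrite -key // coef0; have [] := adm m.
Qed.

Lemma admissible_drop (v : {poly C} * {poly C}) : admissible v -> admissible (drop2 1 v).
Proof.
move=> adm m; have := adm m.+1; congr (_ /\ _).
  by congr (U0 _ = _); congr Phi; rewrite /drop2 /=; congr (_, _);
    apply/polyP => i; rewrite !coef_drop_poly addn1 addnS.
by congr (U1 _ = _); congr Phi; rewrite /drop2 /=; congr (_, _);
    apply/polyP => i; rewrite !coef_drop_poly addn1 addnS.
Qed.

End Boundary.
End GeneralizedSolutions.

(** * The operator, its characteristic function and orders of zeros *)

Section Operator.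
Context {R : realType}.
Local Notation C := R[i].
Local Notation mu := (@lebesgue_measure R).
Variables (b0 : R -> R) (b1 : R -> C).
Variables nu0 nu1 : probability (measurableTypeR R) R.
Hypothesis b0_lt0 : {ae mu, forall x, unitJ x -> b0 x < 0}.
Hypothesis w_L1 : inL1 (weight b0).
Local Notation p := (fun x => b1 x / (b0 x)%:C).
Local Notation w := (weight b0).
Local Notation U0 := (nonlocal_bc nu0 0).
Local Notation U1 := (nonlocal_bc nu1 1).

Lemma weightC (x : R) : (w x)%:C = - ((b0 x)%:C)^-1 :> C.
Proof. by rewrite /weight rmorphN fmorphV. Qed.

Lemma b0C_neq0 (x : R) : b0 x < 0 -> (b0 x)%:C != 0 :> C.
Proof. by move=> b; rewrite -cabs_eq0 cabs_real normr_eq0 lt_eqF. Qed.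

Lemma sol_of_AC2 (l : C) (f y dy ddy : R -> C) : AC2_derivs y dy ddy ->
  aeq (Lexpr b0 b1 dy ddy) (fun x => l * y x + f x) -> sol p w l f y dy.
Proof.
move=> [acy acdy dy1 dy2] E; split; first by split => //; apply: aeW.
split => //; apply: (ae_imp2 dy2 (ae_imp2 E b0_lt0 (fun x a b => conj a b))).
move=> x H [e bx] xJ; have {}bx := b0C_neq0 (bx xJ).
have {}H := H xJ; have {}e := e xJ.
suff <- : ddy x = - (b1 x / (b0 x)%:C * dy x) - (w x)%:C * (l * y x + f x) by [].
by rewrite -e /Lexpr weightC; field.
Qed.

Lemma AC2_of_sol (l : C) (f y dy : R -> C) : sol p w l f y dy ->
  exists2 ddy, AC2_derivs y dy ddy & aeq (Lexpr b0 b1 dy ddy) (fun x => l * y x + f x).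
Proof.
move=> [py pdy].
exists (fun x => - (b1 x / (b0 x)%:C * dy x) - (w x)%:C * (l * y x + f x)).
  split; [exact: py.1 | exact: pdy.1 | exact: cprim_is_cderive py pdy.1 | exact: pdy.2].
apply: (ae_imp b0_lt0) => x bx xJ; have {}bx := b0C_neq0 (bx xJ).
by rewrite /Lexpr weightC; field.
Qed.

Lemma inL2_AC (y : R -> C) : AC01 y -> inL2 w y.
Proof.
move=> /AC01P[y1 y2]; split.
  by split; [exists (fun x => Re (y x)) | exists (fun x => Im (y x))];
    solve [exact: ac_measurable | exact: aeW].
have ac2 : ac (fun x => Re (y x) * Re (y x) + Im (y x) * Im (y x)).
  exact: acD (acM y1 y1) (acM y2 y2).
apply: inL1_ae (inL1_acM ac2 w_L1); apply: aeW => x _.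
by rewrite -!expr2 -cabs_sqr.
Qed.

Lemma inL2_aeq (u y : R -> C) : aeq u y -> inL2 w y -> inL2 w u.
Proof.
move=> uy [[[g1 m1 E1] [g2 m2 E2]] H]; split.
  by split; [exists g1 | exists g2] => //;
    [apply: (ae_imp2 uy E1) | apply: (ae_imp2 uy E2)] => x a b xJ; rewrite a // b.
by apply: inL1_ae H; apply: (ae_imp uy) => x a xJ; rewrite a.
Qed.

(** Membership in the domain of L, with its almost everywhere classes, becomes
    an initial value problem for the absolutely continuous representative. *)
Lemma op_shift_sol (l : C) (u g : R -> C) : op_shift (Lop b0 b1 nu0 nu1) l u g ->
  exists y dy, [/\ aeq u y, sol p w l g y dy, U0 y = 0 & U1 y = 0].
Proof.
move=> [v [y [dy [ddy [[uy _ ac2] [vL _ bc0 bc1]]]]] gv].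
exists y, dy; split => //.
- apply: sol_of_AC2 ac2 _; apply: (ae_imp2 vL (ae_imp2 gv uy (fun x a b => conj a b))).
  by move=> x e1 [e2 e3] xJ; rewrite -e1 // e2 // e3 //; ring.
- by rewrite /nonlocal_bc -bc0 subrr.
- by rewrite /nonlocal_bc -bc1 subrr.
Qed.

Lemma sol_op_shift (l : C) (u y dy g h : R -> C) : aeq u y -> aeq g h -> AC01 h ->
  sol p w l h y dy -> U0 y = 0 -> U1 y = 0 -> op_shift (Lop b0 b1 nu0 nu1) l u g.
Proof.
move=> uy gh ach sy bc0 bc1; have [ddy ac2 E] := AC2_of_sol sy.
have acy : AC01 y by exact: sol_AC sy.
exists (fun x => l * y x + h x); last first.
  by apply: (ae_imp2 uy gh) => x e1 e2 xJ; rewrite e1 // e2 //; ring.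
exists y, dy, ddy; split; split => //.
- by apply: inL2_aeq uy _; exact: inL2_AC.
- by apply: (ae_imp E) => x e xJ; rewrite e.
- by apply: inL2_AC; apply: AC01D => //; apply: AC01M => //; exact: AC01_cst.
- by move/eqP: bc0; rewrite subr_eq0 => /eqP.
- by move/eqP: bc1; rewrite subr_eq0 => /eqP.
Qed.

Lemma is_solution_sol (l c0 c1 : C) (y : R -> C) : is_solution b0 b1 l c0 c1 y ->
  exists dy, [/\ sol p w l (fun=> 0) y dy, y 0 = c0 & dy 0 = c1].
Proof.
move=> [dy [ddy [ac2 E e0 e1]]]; exists dy; split => //.
by apply: sol_of_AC2 ac2 _; apply: (ae_imp E) => x e xJ; rewrite addr0 e.
Qed.

End Operator.

Section ZeroOrder.
Context {R : realType}.
Local Notation C := R[i].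

Lemma near_cabs (z0 : C) (P : C -> Prop) : (\forall z \near (z0 : C^o), P z) ->
  exists2 d : R, 0 < d & forall t, cabs t < d -> P (z0 + t).
Proof.
move=> /nbhs_ballP[r /= r0 H]; exists (Re r); first by move: r0; rewrite ltcE => /andP[].
move=> t td; apply: H; rewrite /ball /= opprD addNKr normrN cabsE ltcE /=.
by move: r0; rewrite ltcE /= => /andP[-> _].
Qed.

Lemma zero_order_eps (f : C -> C) (z0 : C) (n : nat) : zero_order f z0 n ->
  exists g : C -> C, [/\ g 0 != 0,
    forall e, 0 < e -> exists2 d, 0 < d & forall t, cabs t < d -> cabs (g t - g 0) <= e &
    exists2 d, 0 < d & forall t, cabs t < d -> f (z0 + t) = t ^+ n * g t].
Proof.
move=> [g [dg g0 fg]]; exists (fun t => g (z0 + t)); rewrite addr0; split => //.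
  move=> e e0.
  have cg : {for (z0 : C^o), continuous (g : C^o -> C^o)}.
    apply: differentiable_continuous; apply/derivable1_diffP.
    exact: (nbhs_singleton dg).
  have e0' : 0 < e%:C :> C by rewrite ltcR.
  have /cvgrPdist_le /(_ _ e0') /near_cabs[d d0 H] := cg.
  exists d => // t td; have := H t td; rewrite distrC cabsE lecR; exact.
have [d d0 H] := near_cabs fg; exists d => // t /H ->.
by rewrite addrC addKr.
Qed.

Lemma det_mx22 (a b c d : C) : \det (mx22 a b c d) = a * d - b * c.
Proof.
rewrite (expand_det_row _ ord0) !big_ord_recl big_ord0 addr0 /cofactor !det_mx11 !mxE /=.
by rewrite /bump /= expr0 expr1 mul1r mulN1r mulrN.
Qed.

End ZeroOrder.

(** * Algebraic multiplicity *)

Section Multiplicity.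
Context {R : realType}.
Local Notation C := R[i].
Local Notation mu := (@lebesgue_measure R).
Variables (b0 : R -> R) (b1 : R -> C).
Variables nu0 nu1 : probability (measurableTypeR R) R.
Hypothesis b0_lt0 : {ae mu, forall x, unitJ x -> b0 x < 0}.
Hypothesis w_L1 : inL1 (weight b0).
Hypothesis p_L1 : inL1C (fun x => b1 x / (b0 x)%:C).
Hypotheses (nu0J : nu0 unitJ = 1%E) (nu1J : nu1 unitJ = 1%E).
Variable l0 : C.
Local Notation p := (fun x => b1 x / (b0 x)%:C).
Local Notation w := (weight b0).
Local Notation U0 := (nonlocal_bc nu0 0).
Local Notation U1 := (nonlocal_bc nu1 1).
Local Notation T := (op_shift (Lop b0 b1 nu0 nu1) l0).
Variables (z1 z2 : nat -> R -> C) (dy1 dy2 : R -> C).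
Hypotheses (zc1 : jordan_chain p w l0 z1) (zc2 : jordan_chain p w l0 z2).
Hypotheses (s1 : sol p w l0 (fun=> 0) (z1 0%N) dy1) (s2 : sol p w l0 (fun=> 0) (z2 0%N) dy2).
Hypotheses (z10 : z1 0%N 0 = 1) (dy10 : dy1 0 = 0) (z20 : z2 0%N 0 = 0) (dy20 : dy2 0 = 1).

Lemma weight_gt0 : {ae mu, forall x, unitJ x -> 0 < w x}.
Proof.
by apply: (ae_imp b0_lt0) => x H xJ; rewrite /weight oppr_gt0 invr_lt0 H.
Qed.

Let w_gt0 := weight_gt0.
Let bU0 : bounded_functional U0.
Proof. by apply: nonlocal_bc_functional => //; rewrite lexx ler01. Qed.
Let bU1 : bounded_functional U1.
Proof. by apply: nonlocal_bc_functional => //; rewrite lexx ler01. Qed.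

Local Notation Phi := (Phi z1 z2).
Local Notation admissible := (admissible z1 z2 U0 U1).
Let PhiAC v : AC01 (Phi v).
Proof. exact: (Phi_AC zc1 zc2 s1 s2 z10 dy10 z20 dy20). Qed.

Lemma op_pow_Phi (n : nat) : forall v : {poly C} * {poly C},
  (size v.1 <= n)%N -> (size v.2 <= n)%N -> admissible v -> op_pow T n (Phi v) (fun=> 0).
Proof.
elim: n => [|n IH] v n1 n2 adm /=.
  move: n1 n2; rewrite !leqn0 !size_poly_eq0 => /eqP e1 /eqP e2.
  by apply: aeW => x _; rewrite [v]surjective_pairing e1 e2 Phi0.
exists (Phi (drop2 1 v)); last first.
  by apply: IH; rewrite ?size_drop_poly ?leq_subLR //; exact: admissible_drop.
have [d [sd _ _]] := Phi_sol zc1 zc2 s1 s2 z10 dy10 z20 dy20 v.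
have [adm0 adm1] : U0 (Phi v) = 0 /\ U1 (Phi v) = 0.
  by have := adm 0%N; rewrite /drop2 !drop_poly0l -surjective_pairing.
by apply: (sol_op_shift b0_lt0 w_L1 _ _ _ sd) => //; apply: aeW.
Qed.

(** By induction along the chain u, (L - l0) u, ...: each member solves an
    equation whose right-hand side is already of the form Phi v. *)
Lemma Phi_of_op_pow (n : nat) : forall u, op_pow T n u (fun=> 0) ->
  exists v : {poly C} * {poly C}, [/\ aeq u (Phi v), admissible v,
    (size v.1 <= n)%N & (size v.2 <= n)%N].
Proof.
elim: n => [|n IH] u /=.
  move=> u0; exists 0; rewrite !size_poly0; split => //.
    by apply: (ae_imp u0) => x H xJ; rewrite Phi0 -H.
  move=> m; have -> : drop2 m 0 = (0 : {poly C} * {poly C}).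
    by rewrite /drop2 !drop_poly0r.
  have -> : Phi 0 = (fun=> 0) by apply/funext => x; rewrite Phi0.
  by rewrite !functional0.
move=> [f Tuf /IH[v [fv adm n1 n2]]].
have [y [dy [uy sy bc0 bc1]]] := op_shift_sol b0_lt0 Tuf.
have {}sy := sol_eq fv sy.
have [v' dv yv] := sol_Phi p_L1 w_L1 w_gt0 zc1 zc2 s1 s2 z10 dy10 z20 dy20 sy.
have acy : AC01 y by exact: sol_AC sy.
exists v'; split.
- by apply: (ae_imp uy) => x H xJ; rewrite H // yv // unitJ_bounds.
- case=> [|m].
    rewrite /drop2 !drop_poly0l -surjective_pairing.
    by rewrite -(functional_eq bU0 acy (PhiAC v') yv) -(functional_eq bU1 acy (PhiAC v') yv).
  have -> : drop2 m.+1 v' = drop2 m v; last exact: adm.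
  rewrite -dv /drop2 /=; congr (_, _); apply/polyP => i;
    by rewrite !coef_drop_poly addn1 addnS.
- by move: n1; rewrite -dv /= size_drop_poly leq_subLR add1n.
- by move: n2; rewrite -dv /= size_drop_poly leq_subLR add1n.
Qed.

(** A vector of the generalized eigenspace may a priori involve more than n0
    terms of the chains, which requires a long truncation of the matrix; but the
    kernel of every truncation consists of polynomials of size at most n0, so that
    the basis obtained for the shortest truncation spans. *)
Lemma gen_eigenspace_dim (n0 : nat) :
  (forall N, (n0 <= N)%N -> exists2 q : {poly C},
     bc_poly U0 z1 N.+1 * bc_poly U1 z2 N.+1 - bc_poly U0 z2 N.+1 * bc_poly U1 z1 N.+1
       = q * 'X^n0 & q`_0 != 0) ->
  has_dim (gen_eigenspace (Lop b0 b1 nu0 nu1) l0) n0.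
Proof.
move=> ord.
have basis N : (n0 <= N)%N -> ker2_basis (bc_poly U0 z1 N.+1) (bc_poly U0 z2 N.+1)
    (bc_poly U1 z1 N.+1) (bc_poly U1 z2 N.+1) n0.
  by move=> nN; have [q qE q0] := ord N nN; exact: ker2_basisP qE q0.
have admP := admissibleP zc1 zc2 bU0 bU1.
have [e [eK eI eS]] := basis n0 (leqnn n0).
exists (fun i => Phi (e i)); split.
- move=> i; have [ker_e n1 n2] := eK i; exists n0 => //.
  apply: (@op_pow_Phi n0.+1); rewrite ?(leqW n1) ?(leqW n2) //.
  by apply/(admP _ n0.+1); rewrite ?(leqW n1) ?(leqW n2).
- move=> c c0; apply: eI.
  apply: (Phi_injective w_gt0 zc1 zc2 s1 s2 z10 dy10 z20 dy20).
  by apply: (ae_imp c0) => x H xJ; rewrite Phi_sum H.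
- move=> u [n _ /Phi_of_op_pow[v [uv adm n1 n2]]].
  have [m1 m2] : (size v.1 <= n0)%N /\ (size v.2 <= n0)%N.
    (* A truncation long enough both for v and for the determinant. *)
    pose N := maxn n n0.
    have nN : (n <= N)%N := leq_maxl _ _.
    have [e' [eK' _ eS']] := basis N (leq_maxr _ _).
    have /eS'[c ->] : ker2 (bc_poly U0 z1 N.+1) (bc_poly U0 z2 N.+1)
      (bc_poly U1 z1 N.+1) (bc_poly U1 z2 N.+1) v.
      by apply/(admP _ N.+1); rewrite ?(leq_trans n1) ?(leq_trans n2).
    rewrite pair_sumE /=; split; apply: (leq_trans (size_sum _ _ _)); apply/bigmax_leqP => i _;
      by rewrite (leq_trans (size_scale_leq _ _)) //; have [] := eK' i.
  have /eS[c vc] : ker2 (bc_poly U0 z1 n0.+1) (bc_poly U0 z2 n0.+1)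
      (bc_poly U1 z1 n0.+1) (bc_poly U1 z2 n0.+1) v.
    by apply/(admP _ n0.+1); rewrite ?(leqW m1) ?(leqW m2).
  by exists c; apply: (ae_imp uv) => x H xJ; rewrite H // vc Phi_sum.
Qed.

End Multiplicity.

Section CharacteristicFunction.
Context {R : realType}.
Local Notation C := R[i].
Variables (p : R -> C) (w : R -> R).
Hypotheses (p_L1 : inL1C p) (w_L1 : inL1 w).
Hypothesis w_ge0 : {ae (@lebesgue_measure R), forall x, unitJ x -> 0 <= w x}.

(** The entries of the characteristic matrix have the Taylor polynomials
    [bc_poly]. *)
Lemma bc_taylor (U : (R -> C) -> C) (l0 : C) (z : nat -> R -> C) (dz0 : R -> C)
    (y : R -> C -> C) (N : nat) : bounded_functional U ->
  jordan_chain p w l0 z -> sol p w l0 (fun=> 0) (z 0%N) dz0 ->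
  (forall l, exists dy, [/\ sol p w l (fun=> 0) (y^~ l) dy, y 0 l = z 0%N 0 & dy 0 = dz0 0]) ->
  isO N.+1 (fun t => U (y^~ (l0 + t)) - (bc_poly U z N.+1).[t]).
Proof.
move=> bU zc s0 ysol.
have [D D0 HD] := chain_taylor p_L1 w_L1 w_ge0 N zc s0.
have [lin [B bnd]] := bU.
exists (`|B| * D) => [|t t1]; first by rewrite mulr_ge0.
have acz k : AC01 (z k) by exact: jordan_chain_AC zc.
have [dy [sy y0 dy0]] := ysol (l0 + t).
have tE : l0 + t - l0 = t by rewrite addrC addKr.
have := HD (l0 + t) _ _ _ sy y0 dy0; rewrite tE => /(_ t1) H.
have acS : AC01 (fun x => \sum_(k < N.+1) t ^+ k * z k x) by exact: AC01_sum.
have acy := sol_AC sy.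
have -> : U (y^~ (l0 + t)) - (bc_poly U z N.+1).[t] =
    U (fun x => -1 * (\sum_(k < N.+1) t ^+ k * z k x) + y x (l0 + t)).
  rewrite lin // functional_sum // mulN1r addrC; congr (- _ + _).
  by rewrite horner_poly; apply: eq_bigr => k _; rewrite mulrC.
apply: (@le_trans _ _ (B * (D * cabs t ^+ N.+1))).
  apply: bnd; first by apply: AC01D => //; apply: AC01M => //; exact: AC01_cst.
  by move=> x xI; rewrite mulN1r addrC H.
rewrite -mulrA ler_wpM2r ?ler_norm // mulr_ge0 ?exprn_ge0 ?cabs_ge0 //.
Qed.

End CharacteristicFunction.

Theorem theorem1p1 (R : realType) (b0 : R -> R) (b1 : R -> R[i])
    (nu0 nu1 : probability (measurableTypeR R) R)
    (y1 y2 : R -> R[i] -> R[i]) (lambda0 : R[i]) (n0 : nat)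
    (mb0 : lmeasurable b0) (mb1 : clmeasurable b1)
    (b0_lt0 : {ae (@lebesgue_measure R), forall x, unitJ x -> b0 x < 0})
    (w_L1 : inL1 (weight b0))
    (b1b0_L1 : inL1C (fun x => b1 x / (b0 x)%:C))
    (nu0J : nu0 unitJ = 1%E) (nu1J : nu1 unitJ = 1%E)
    (y1_sol : forall l, is_solution b0 b1 l 1 0 (y1^~ l))
    (y2_sol : forall l, is_solution b0 b1 l 0 1 (y2^~ l))
    (lambda0_eig : eigenvalue_of (Lop b0 b1 nu0 nu1) lambda0)
    (order_lambda0 : zero_order (char_fun nu0 nu1 y1 y2) lambda0 n0) :
  has_dim (gen_eigenspace (Lop b0 b1 nu0 nu1) lambda0) n0.
Proof.
have sol1 l := is_solution_sol b0_lt0 (y1_sol l).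
have sol2 l := is_solution_sol b0_lt0 (y2_sol l).
have [dy1 [s1 i1 di1]] := sol1 lambda0; have [dy2 [s2 i2 di2]] := sol2 lambda0.
have [z1 zc1 z1E] := jordan_chain_exists b1b0_L1 w_L1 s1 s2 i1 di1 i2 di2 s1.
have [z2 zc2 z2E] := jordan_chain_exists b1b0_L1 w_L1 s1 s2 i1 di1 i2 di2 s2.
have z10 : z1 0%N 0 = 1 by rewrite z1E.
have z20 : z2 0%N 0 = 0 by rewrite z2E.
rewrite -z1E in s1; rewrite -z2E in s2.
apply: (gen_eigenspace_dim b0_lt0 w_L1 b1b0_L1 nu0J nu1J zc1 zc2 s1 s2 z10 di1 z20 di2).
move=> N nN; set P := _ - _.
have w_ge0 : {ae (@lebesgue_measure R), forall x, unitJ x -> 0 <= weight b0 x}.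
  by apply: (ae_imp (weight_gt0 b0_lt0)) => x H /H /ltW.
have I0 : 0 <= (0 : R) <= 1 by rewrite lexx ler01.
have I1 : 0 <= (1 : R) <= 1 by rewrite lexx ler01.
have bU0 := nonlocal_bc_functional nu0J I0; have bU1 := nonlocal_bc_functional nu1J I1.
have sol1' l : exists dy, [/\ sol (fun x => b1 x / (b0 x)%:C) (weight b0) l (fun=> 0) (y1^~ l) dy,
    y1 0 l = z1 0%N 0 & dy 0 = dy1 0] by rewrite z10 di1; exact: sol1.
have sol2' l : exists dy, [/\ sol (fun x => b1 x / (b0 x)%:C) (weight b0) l (fun=> 0) (y2^~ l) dy,
    y2 0 l = z2 0%N 0 & dy 0 = dy2 0] by rewrite z20 di2; exact: sol2.
have t01 := bc_taylor b1b0_L1 w_L1 w_ge0 N bU0 zc1 s1 sol1'.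
have t02 := bc_taylor b1b0_L1 w_L1 w_ge0 N bU0 zc2 s2 sol2'.
have t11 := bc_taylor b1b0_L1 w_L1 w_ge0 N bU1 zc1 s1 sol1'.
have t12 := bc_taylor b1b0_L1 w_L1 w_ge0 N bU1 zc2 s2 sol2'.
have DeltaO : isO N.+1 (fun t => char_fun nu0 nu1 y1 y2 (lambda0 + t) - P.[t]).
  (* Products of expansions are controlled because both factors are bounded. *)
  have O0 (f : R[i] -> R[i]) (Q : {poly R[i]}) : isO N.+1 (fun t => f t - Q.[t]) -> isO 0 f.
    move=> [D D0 HD]; have [E E0 HE] := isO_horner Q.
    exists (D + E) => [|t t1]; first exact: addr_ge0.
    have -> : f t = (f t - Q.[t]) + Q.[t] by rewrite subrK.
    rewrite (le_trans (cabsD _ _)) // mulrDl lerD ?HE // (le_trans (HD t t1)) //.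
    by rewrite expr0 mulr1 ler_piMr // exprn_ile1 ?cabs_ge0.
  have prodO (f g : R[i] -> R[i]) (Q S : {poly R[i]}) : isO N.+1 (fun t => f t - Q.[t]) ->
      isO N.+1 (fun t => g t - S.[t]) -> isO N.+1 (fun t => f t * g t - (Q * S).[t]).
    move=> hf hg; have h1 := isOM hf (O0 _ _ hg); have h2 := isOM (isO_horner Q) hg.
    rewrite addn0 in h1; rewrite add0n in h2.
    by apply: isO_eq (isOD h1 h2) => t; rewrite hornerM; ring.
  apply: isO_eq (isOD (prodO _ _ _ _ t01 t12) (isON (prodO _ _ _ _ t02 t11))) => t.
  rewrite /char_fun det_mx22 /P hornerD hornerN /nonlocal_bc.
  have [_ [_ -> _]] := sol1 (lambda0 + t); have [_ [_ -> _]] := sol2 (lambda0 + t).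
  by rewrite subr0; ring.
have [g [g0 gc [d d0 gE]]] := zero_order_eps order_lambda0.
have [Q QE Q0] : exists2 Q, P = Q * 'X^n0 & Q`_0 = g 0.
  apply: poly_order gc _; have [D D0 HD] := DeltaO.
  exists D; exists (Num.min 1 d); first by rewrite lt_min ltr01.
  move=> t; rewrite lt_min => /andP[_ /andP[t1 td]].
  rewrite -gE // -cabsN opprB; apply: le_trans (HD t (ltW t1)) _.
  rewrite ler_wpM2l //; apply: ler_wiXn2l; rewrite ?cabs_ge0 ?ltW //.
by exists Q => //; rewrite Q0.
Qed.
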